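(* Suppose $n$ is an odd integer with $1\leq n<\min\{t_1,t_2,t_3\}$. Then the $\mathfrak{BI}$-module $\mathscr M_n$ is isomorphic to $W\oplus W$, where $W=E_n\big(k_2+k_3+\tfrac{n+1}{2},\,-k_1-k_3-\tfrac{n+1}{2},\,k_1+k_2+\tfrac{n+1}{2}\big)$. Moreover, if $k_1,k_2,k_3\geq 0$, then $W$ is irreducible and is isomorphic to $E_n\big(k_2+k_3+\tfrac{n+1}{2},\,k_1+k_3+\tfrac{n+1}{2},\,k_1+k_2+\tfrac{n+1}{2}\big)$.
   Context: Fix real numbers $k_1,k_2,k_3$. For $i=1,2,3$ let $R_i$ be the operator on functions on $\mathbb R^3$ replacing $x_i$ by $-x_i$, and let $T_i$ be the Dunkl operator $T_if=\frac{\partial f}{\partial x_i}+k_i\frac{f-R_if}{x_i}$. Let $\sigma_1=\begin{pmatrix}0&1\\1&0\end{pmatrix}$, $\sigma_2=\begin{pmatrix}0&-\sqrt{-1}\\ \sqrt{-1}&0\end{pmatrix}$, $\sigma_3=\begin{pmatrix}1&0\\0&-1\end{pmatrix}$, and let $e_i$ act on $\mathbb C^2$ by $\sigma_i$. Tensor products are over $\mathbb R$; $\mathbb R[x_1,x_2,x_3]_n$ denotes homogeneous polynomials of degree $n$. Let $\mathbf D=e_1\otimes T_1+e_2\otimes T_2+e_3\otimes T_3$ and $\mathscr M_n=\ker(\mathbf D|_{\mathbb C^2\otimes\mathbb R[x_1,x_2,x_3]_n})$. For $i=1,2,3$ set $t_i=-2k_i$ if $2k_i$ is an odd negative integer, and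 $t_i=\infty$ otherwise. The universal Bannai–Ito algebra $\mathfrak{BI}$ is the unital associative $\mathbb C$-algebra generated by $X,Y,Z$ with relations saying that $\kappa=\{X,Y\}-Z$, $\lambda=\{Y,Z\}-X$, $\mu=\{Z,X\}-Y$ commute with $X,Y,Z$ (here $\{A,B\}=AB+BA$). $\mathscr M_n$ is a $\mathfrak{BI}$-module via $X=(\sqrt{-1}\,e_1\otimes(x_3T_2-x_2T_3)+\tfrac12)R_2R_3+k_2R_3+k_3R_2$, $Y=(\sqrt{-1}\,e_2\otimes(x_1T_3-x_3T_1)+\tfrac12)R_1R_3+k_3R_1+k_1R_3$, $Z=(\sqrt{-1}\,e_3\otimes(x_2T_1-x_1T_2)+\tfrac12)R_1R_2+k_1R_2+k_2R_1$, with operators composed right to left and $R_i$ acting on the polynomial factor. For $a,b,c\in\mathbb C$ and odd $d\geq1$, $E_d(a,b,c)$ is the $\mathfrak{BI}$-module $\mathbb C^{d+1}$ in which, w.r.t. a basis $v_0,\dots,v_d$, $X$ acts by the lower bidiagonal matrix with diagonal $(\theta_0,\dots,\theta_d)$ and all subdiagonal entries $1$, $Y$ acts by the upper bidiagonal matrix with diagonal $(\theta^*_0,\dots,\theta^*_d)$ and superdiagonal $(\varphi_1,\dots,\varphi_d)$, and $Z=\{X,Y\}-\big(c^2-a^2-b^2+\frac{(d+1)^2}{4}\big)$, where $\theta_i=\frac{(-1)^i(2a-d+2i)}{2}$, $\theta^*_i=\frac{(-1)^i(2b-d+2i)}{2}$, $\varphi_i=i(d-i+1)$ for $i$ even and $\varphi_i=c^2-\frac{(2a+2b-d+2i-1)^2}{4}$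 for $i$ odd. *)

(* Defs.v *)
From HB Require Import structures.
From mathcomp Require Import all_boot all_order all_algebra.
From mathcomp Require Import reals.
From mathcomp Require Import mpoly.
From mathcomp.real_closed Require Import complex.

Set Implicit Arguments.
Unset Strict Implicit.
Unset Printing Implicit Defensive.

Import Order.TTheory GRing.Theory Num.Theory.
Local Open Scope ring_scope.

Section BannaiIto.

Variable R : realType.

Local Notation C := (complex R).

Definition rC (x : R) : C := Complex x 0.

Definition i1 : 'I_3 := @Ordinal 3 0 isT.
Definition i2 : 'I_3 := @Ordinal 3 1 isT.
Definition i3 : 'I_3 := @Ordinal 3 2 isT.

Definition Pol := {mpoly C[3]}.

Definition refl (i : 'I_3) (p : Pol) : Pol :=
  p \mPo [tuple (if j == i then - 'X_j else 'X_j) | j < 3].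

(* exact division by x_i: the polynomial whose coefficient at m is the
   coefficient of p at m + e_i.  When x_i divides p (e.g. p = f - R_i f),
   this is the quotient p / x_i. *)
Definition mdivX (i : 'I_3) (p : Pol) : Pol :=
  \sum_(m <- msupp p | (0 < m i)%N) p@_m *: 'X_[mnm_sub m (mnm1 i)].

Definition dunkl (k : R) (i : 'I_3) (p : Pol) : Pol :=
  mderiv i p + rC k *: mdivX i (p - refl i p).

(* C^2 (x)_R R[x_1,x_2,x_3] is identified with pairs of complex polynomials:
   v (x) f  |->  (v_1 f, v_2 f). *)
Definition Pair := (Pol * Pol)%type.

Definition pmap (f : Pol -> Pol) (u : Pair) : Pair := (f u.1, f u.2).

(* Pauli matrices acting on the C^2 factor *)
Definition sig1 (u : Pair) : Pair := (u.2, u.1).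
Definition sig2 (u : Pair) : Pair := (- ('i *: u.2), 'i *: u.1).
Definition sig3 (u : Pair) : Pair := (u.1, - u.2).

Definition Rp (i : 'I_3) := pmap (refl i).
Definition Tp (k : R) (i : 'I_3) := pmap (dunkl k i).
Definition Xp (i : 'I_3) := pmap (fun p => 'X_i * p).
Definition addP (u v : Pair) : Pair := (u.1 + v.1, u.2 + v.2).
Definition subP (u v : Pair) : Pair := (u.1 - v.1, u.2 - v.2).
Definition scaleP (c : C) (u : Pair) : Pair := (c *: u.1, c *: u.2).

Definition Dirac (k1 k2 k3 : R) (u : Pair) : Pair :=
  addP (sig1 (Tp k1 i1 u)) (addP (sig2 (Tp k2 i2 u)) (sig3 (Tp k3 i3 u))).

Definition inMn (k1 k2 k3 : R) (n : nat) (u : Pair) : Prop :=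
  u.1 \is n.-homog /\ u.2 \is n.-homog /\ Dirac k1 k2 k3 u = (0, 0).

Definition half : C := 2%:R^-1.

Definition BIX (k1 k2 k3 : R) (u : Pair) : Pair :=
  let v := Rp i2 (Rp i3 u) in
  let w := subP (Xp i3 (Tp k2 i2 v)) (Xp i2 (Tp k3 i3 v)) in
  addP (addP (scaleP 'i (sig1 w)) (scaleP half v))
       (addP (scaleP (rC k2) (Rp i3 u)) (scaleP (rC k3) (Rp i2 u))).

Definition BIY (k1 k2 k3 : R) (u : Pair) : Pair :=
  let v := Rp i1 (Rp i3 u) in
  let w := subP (Xp i1 (Tp k3 i3 v)) (Xp i3 (Tp k1 i1 v)) in
  addP (addP (scaleP 'i (sig2 w)) (scaleP half v))
       (addP (scaleP (rC k3) (Rp i1 u)) (scaleP (rC k1) (Rp i3 u))).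

Definition BIZ (k1 k2 k3 : R) (u : Pair) : Pair :=
  let v := Rp i1 (Rp i2 u) in
  let w := subP (Xp i2 (Tp k1 i1 v)) (Xp i1 (Tp k2 i2 v)) in
  addP (addP (scaleP 'i (sig3 w)) (scaleP half v))
       (addP (scaleP (rC k1) (Rp i2 u)) (scaleP (rC k2) (Rp i1 u))).

(* t_i condition: n < t_i, where t_i = -2k_i if 2k_i is an odd negative
   integer and t_i = infinity otherwise *)
Definition below_t (k : R) (n : nat) : Prop :=
  forall m : nat, 2%:R * k = - (2 * m + 1)%N%:R -> n%:R < - (2%:R * k).

(* The module E_d(a,b,c) on C^{d+1}, basis v_0..v_d = standard column
   basis, matrices acting on column vectors. *)
Definition thetaE (a : C) (d i : nat) : C :=
  (-1) ^+ i * (2%:R * a - d%:R + 2%:R * i%:R) / 2%:R.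

Definition phiE (a b c : C) (d i : nat) : C :=
  if ~~ odd i then (i * (d - i + 1))%N%:R
  else c ^+ 2 - (2%:R * a + 2%:R * b - d%:R + 2%:R * i%:R - 1) ^+ 2 / 4%:R.

Definition EX (a : C) (d : nat) : 'M[C]_(d.+1) :=
  \matrix_(i, j) (if i == j then thetaE a d i
                  else if (i == j.+1 :> nat) then 1 else 0).

Definition EY (a b c : C) (d : nat) : 'M[C]_(d.+1) :=
  \matrix_(i, j) (if i == j then thetaE b d i
                  else if (j == i.+1 :> nat) then phiE a b c d j else 0).

Definition EZ (a b c : C) (d : nat) : 'M[C]_(d.+1) :=
  EX a d *m EY a b c d + EY a b c d *m EX a d
  - (c ^+ 2 - a ^+ 2 - b ^+ 2 + (d.+1)%:R ^+ 2 / 4%:R)%:M.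

End BannaiIto.

Definition irreducible3 (F : fieldType) (m : nat) (A B D : 'M[F]_m) : Prop :=
  forall S : 'cV[F]_m -> Prop,
    S 0 ->
    (forall (c : F) u v, S u -> S v -> S (c *: u + v)) ->
    (forall u, S u -> S (A *m u)) ->
    (forall u, S u -> S (B *m u)) ->
    (forall u, S u -> S (D *m u)) ->
    (forall u, S u -> u = 0) \/ (forall u, S u).

(* Main.v *)
Require Import Defs.
From HB Require Import structures.
From mathcomp Require Import all_boot all_order all_algebra.
From mathcomp Require Import reals.
From mathcomp Require Import mpoly.
From mathcomp.real_closed Require Import complex.
From mathcomp Require Import ring zify.
From mathcomp Require boolp.
Import Order.TTheory GRing.Theory Num.Theory.
Local Open Scope ring_scope.

(** A polynomial spinor in the kernel of D is determined by its restriction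
    to x_3 = 0, and every homogeneous restriction extends (the Dunkl version of
    the Cauchy-Kovalevskaya extension), because T_3 x_3^j = [j]_{k_3} x_3^{j-1}
    with [j]_k = j + k (1 - (-1)^j) nonzero for 0 < j <= n.  The operators
    X, Y, Z commute with D, so they can be computed on restrictions: in the
    monomial basis x_1^{n-i} x_2^i of either component of C^2, X is lower
    bidiagonal, Y is upper bidiagonal, and after a rescaling (possible since
    [j]_{k_1} <> 0) each component is E_n(a, b, c).

    For the second part, let q be the eigenvector of Y for its last diagonal
    entry, and let the "flip" be the matrix with columns q, (X - theta_0) q,
    (X - theta_1)(X - theta_0) q, ...  It commutes with X.  The defining
    relation of the Bannai-Ito algebra that is linear in Y depends on b only
    through b^2, so Delta = Y_b flip - flip Y_{-b} satisfies
    X^2 Delta + 2 X Delta X + Delta X^2 = Delta; as Delta kills the first two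
    basis vectors, it vanishes.  The flip is triangular and the superdiagonal of
    Y_b flip = flip Y_{-b} is a recursion for its diagonal, which is therefore
    nonzero.  Finally the last coordinate is a left eigenvector of Y, so a nonzero
    invariant subspace contains q, which is cyclic for X. *)

(** * Coefficient arrays of spinors *)

Section CoefficientArrays.
Variables (F : fieldType) (im : F).
Hypothesis im2 : im * im = -1.
Variables k1 k2 k3 : F.

(* [f s a b c] is the coefficient of x_1^a x_2^b x_3^c in the first ([s = false])
   or second ([s = true]) component of a spinor. *)
Definition array := bool -> nat -> nat -> nat -> F.

Definition sgn (m : nat) : F := (-1) ^+ m.
Definition dint (k : F) (m : nat) : F := m%:R + k * (1 - sgn m).
(** Effect on coefficients of multiplication by a variable; it will also serve as the subdiagonal of
    ones in $X$. *)
Definition mulvar (g : nat -> F) (m : nat) : F := if m is m'.+1 then g m' else 0.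

(** The factors [sgn s] and [im] come from the Pauli matrices; $T_i$ moves the coefficient at
    exponent $m+1$, times [dint] of $m+1$, to exponent $m$. *)
Definition dirac_arr (f : array) : array := fun s a b c =>
  dint k1 a.+1 * f (~~ s) a.+1 b c
  + (- sgn s * (im * (dint k2 b.+1 * f (~~ s) a b.+1 c))
     + sgn s * (dint k3 c.+1 * f s a b c.+1)).

(** The reflections act first, hence [sgn b.+1] on the coefficients shifted by $T_2$ and [sgn c.+1]
    on those shifted by $T_3$. *)
Definition biX_arr (f : array) : array := fun s a b c =>
  im * (mulvar (fun c => dint k2 b.+1 * (sgn b.+1 * (sgn c * f (~~ s) a b.+1 c))) c
      - mulvar (fun b => dint k3 c.+1 * (sgn b * (sgn c.+1 * f (~~ s) a b c.+1))) b)
  + 2%:R^-1 * (sgn b * (sgn c * f s a b c))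
  + (k2 * (sgn c * f s a b c) + k3 * (sgn b * f s a b c)).

Definition biY_arr (f : array) : array := fun s a b c =>
  im * (- sgn s * (im * (
        mulvar (fun a => dint k3 c.+1 * (sgn a * (sgn c.+1 * f (~~ s) a b c.+1))) a
      - mulvar (fun c => dint k1 a.+1 * (sgn a.+1 * (sgn c * f (~~ s) a.+1 b c))) c)))
  + 2%:R^-1 * (sgn a * (sgn c * f s a b c))
  + (k3 * (sgn a * f s a b c) + k1 * (sgn c * f s a b c)).

Definition biZ_arr (f : array) : array := fun s a b c =>
  im * (sgn s * (mulvar (fun b => dint k1 a.+1 * (sgn a.+1 * (sgn b * f s a.+1 b c))) b
      - mulvar (fun a => dint k2 b.+1 * (sgn a * (sgn b.+1 * f s a b.+1 c))) a))
  + 2%:R^-1 * (sgn a * (sgn b * f s a b c))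
  + (k1 * (sgn b * f s a b c) + k2 * (sgn a * f s a b c)).

Lemma sgnS m : sgn m.+1 = - sgn m. Proof. by rewrite /sgn exprS mulN1r. Qed.
Lemma sgn0 : sgn 0 = 1. Proof. by []. Qed.
Lemma sgn2 m : sgn m * sgn m = 1. Proof. by rewrite /sgn -expr2 sqrr_sign. Qed.

Hypothesis two_neq0 : 2%:R != 0 :> F.

Lemma sgn_or m : sgn m = 1 \/ sgn m = -1.
Proof. by rewrite /sgn -signr_odd; case: odd; [right|left]. Qed.

Lemma dint0 k : dint k 0 = 0. Proof. by rewrite /dint sgn0; ring. Qed.

(* With [m] weighted by [2 * 2^-1] the commutation identities below become homogeneous
   in [2^-1, k1, k2, k3], hence provable by [ring] without using [2 != 0]. *)
Lemma dintE k m : dint k m = 2%:R * 2%:R^-1 * m%:R + k * (1 - sgn m).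
Proof. by rewrite divff // mul1r. Qed.

(** After splitting on zero exponents, where [mulvar] gives 0, and on parities, commutation is a
    polynomial identity modulo [im * im = -1]. *)
Lemma dirac_biX f s a b c : dirac_arr (biX_arr f) s a b c = biX_arr (dirac_arr f) s a b c.
Proof.
rewrite /dirac_arr /biX_arr ?negbK !dintE; set h := 2%:R^-1.
case: s b c => -[|b] [|c] /=; rewrite ?dintE -/h ?sgnS ?sgn0 ?sgnS ?sgn0;
by [ring: im2 | case: (sgn_or b) => ->; ring: im2 | case: (sgn_or c) => ->; ring: im2
   | case: (sgn_or b) => ->; case: (sgn_or c) => ->; ring: im2].
Qed.

Lemma dirac_biY f s a b c : dirac_arr (biY_arr f) s a b c = biY_arr (dirac_arr f) s a b c.
Proof.
rewrite /dirac_arr /biY_arr ?negbK !dintE; set h := 2%:R^-1.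
case: s a c => -[|a] [|c] /=; rewrite ?dintE -/h ?sgnS ?sgn0 ?sgnS ?sgn0;
by [ring: im2 | case: (sgn_or a) => ->; ring: im2 | case: (sgn_or c) => ->; ring: im2
   | case: (sgn_or a) => ->; case: (sgn_or c) => ->; ring: im2].
Qed.

Lemma dirac_biZ f s a b c : dirac_arr (biZ_arr f) s a b c = biZ_arr (dirac_arr f) s a b c.
Proof.
rewrite /dirac_arr /biZ_arr ?negbK !dintE; set h := 2%:R^-1.
case: s a b => -[|a] [|b] /=; rewrite ?dintE -/h ?sgnS ?sgn0 ?sgnS ?sgn0;
by [ring: im2 | case: (sgn_or a) => ->; ring: im2 | case: (sgn_or b) => ->; ring: im2
   | case: (sgn_or a) => ->; case: (sgn_or b) => ->; ring: im2].
Qed.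

Definition homog_array n (f : array) := forall s a b c, (a + b + c)%N != n -> f s a b c = 0.
Definition monogenic n (f : array) := homog_array n f /\ forall s a b c, dirac_arr f s a b c = 0.

Lemma monogenic_biX n f : monogenic n f -> monogenic n (biX_arr f).
Proof.
move=> [hf df]; split=> s a b c; last first.
  by rewrite dirac_biX /biX_arr; case: b c => [|b] [|c] /=; rewrite !df; ring.
by move=> ne; rewrite /biX_arr; case: b c ne => [|b] [|c] /= ne; rewrite !hf; try lia; ring.
Qed.

Lemma monogenic_biY n f : monogenic n f -> monogenic n (biY_arr f).
Proof.
move=> [hf df]; split=> s a b c; last first.
  by rewrite dirac_biY /biY_arr; case: a c => [|a] [|c] /=; rewrite !df; ring.
by move=> ne; rewrite /biY_arr; case: a c ne => [|a] [|c] /= ne; rewrite !hf; try lia; ring.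
Qed.

Lemma monogenic_biZ n f : monogenic n f -> monogenic n (biZ_arr f).
Proof.
move=> [hf df]; split=> s a b c; last first.
  by rewrite dirac_biZ /biZ_arr; case: a b => [|a] [|b] /=; rewrite !df; ring.
by move=> ne; rewrite /biZ_arr; case: a b ne => [|a] [|b] /= ne; rewrite !hf; try lia; ring.
Qed.

(** Since $\sigma_3^2=1$, the equation $\mathbf D f=0$ solves to
    $T_3f=-\sigma_3\sigma_1T_1f-\sigma_3\sigma_2T_2f$, which expresses the slice $x_3^{c+1}$ by the
    slice $x_3^c$. *)
Lemma monogenic_dint3 n f s a b c : monogenic n f ->
  dint k3 c.+1 * f s a b c.+1 =
    - sgn s * (dint k1 a.+1 * f (~~ s) a.+1 b c) + im * (dint k2 b.+1 * f (~~ s) a b.+1 c).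
Proof.
move=> [_ /(_ s a b c)]; rewrite /dirac_arr; have := sgn2 s; set e := sgn s => e2 H.
set T := _ * f s a b c.+1 in H *.
have -> : T = e * e * T by rewrite e2 mul1r.
have -> : im = e * e * im by rewrite e2 mul1r.
apply/eqP; rewrite -subr_eq0; apply/eqP.
set A := dint k1 _ * _ in H *; set B := dint k2 _ * _ in H *.
rewrite -[RHS](mulr0 e) -H; ring.
Qed.

(** Uniqueness half of the Cauchy-Kovalevskaya extension, by induction on the exponent of $x_3$;
    homogeneity confines the divisions to exponents at most $n$. *)
Lemma monogenic_uniq n f g : (forall j, (0 < j <= n)%N -> dint k3 j != 0) ->
  monogenic n f -> monogenic n g -> (forall s a b, f s a b 0%N = g s a b 0%N) ->
  forall s a b c, f s a b c = g s a b c.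
Proof.
move=> k3n mf mg fg0 s a b c; elim: c s a b => // c IH s a b.
case: (altP (a + b + c.+1 =P n)%N) => [E|ne]; last by rewrite mf.1 // mg.1.
have c_n : (0 < c.+1 <= n)%N by lia.
by apply: (mulfI (k3n _ c_n)); rewrite (monogenic_dint3 _ _ _ _ _ _ mf) (monogenic_dint3 _ _ _
  _ _ _ mg) !IH.
Qed.

(** * Action of $X$, $Y$, $Z$ on restrictions to $x_3=0$ *)

Section Restriction.
Variable n : nat.
Hypothesis n_odd : odd n.

(** Diagonals of $X$ and $Y$ and superdiagonal of $Y$ on restrictions; [theta_pa], [theta_pb] and
    [phiY_vphi] identify them with the data of $E_n(a,b,c)$. *)
Definition th (i : nat) : F := sgn i * (k2 + k3 + 2%:R^-1 + i%:R).
Definition thetaY (i : nat) : F := sgn i * (i%:R - n%:R - k1 - k3 - 2%:R^-1).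
Definition phiY (i : nat) : F := dint k2 i * dint k1 (n.+1 - i).

(* The scalars that turn the subdiagonal entries of X into 1. *)
Fixpoint ck_coef (s : bool) (i : nat) : F :=
  if i is i'.+1 then ck_coef s i' * (im * sgn s * sgn i' * dint k1 (n - i')) else 1.

Definition biX_seq (w : nat -> F) i := th i * w i + mulvar w i.
Definition biY_seq (w : nat -> F) i := thetaY i * w i + phiY i.+1 * w i.+1.
Definition biZ_seq (w : nat -> F) i := (sgn i * (k1 - k2) - 2%:R^-1) * w i
  + mulvar (fun j => - sgn j * w j) i - sgn i * phiY i.+1 * w i.+1.

(** [w] lists the coordinates of the component [s] at $x_3=0$ in the monomials $x_1^{n-i}x_2^i$
    rescaled by [ck_coef s i]. *)
Definition restricts (f : array) s (w : nat -> F) :=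
  forall i, (i <= n)%N -> f s (n - i)%N i 0%N = ck_coef s i * w i.

Lemma phiY_last : phiY n.+1 = 0.
Proof. by rewrite /phiY subnn /dint sgn0; ring. Qed.

Lemma sgnB i : (i <= n)%N -> sgn (n - i) = - sgn i.
Proof.
by move=> le; rewrite /sgn -signr_odd oddB // n_odd -[in RHS]signr_odd; case: odd => /=;
  rewrite ?opprK.
Qed.

(** In plain monomials the superdiagonal of $Y$ carries, up to sign, the same factor
    [im * sgn s * sgn i] as the subdiagonal of $X$. The rescaling cancels it, so both components get
    the same [phiY]. *)
Lemma ck_coef_im s i : ck_coef s i.+1 * (- im * sgn s * sgn i * dint k2 i.+1) = ck_coef s i *
  phiY i.+1.
Proof.
rewrite /= /phiY subSS.
transitivity (ck_coef s i * (dint k2 i.+1 * dint k1 (n - i)) * (- (im * im)) * (sgn s * sgn s)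
  * (sgn i * sgn i)).
  ring.
by rewrite im2 !sgn2; ring.
Qed.

Lemma sgn_negb (s : bool) : sgn (~~ s) = - sgn s.
Proof. by case: s; rewrite /sgn /= ?expr0 ?expr1 ?opprK. Qed.

(** At $x_3=0$, $X$ involves the coefficient of $x_3$ in the other component; [monogenic_dint3]
    trades it for coefficients at $x_3=0$ of the component [s] itself. *)
Lemma restricts_biX f s w : monogenic n f -> restricts f s w -> restricts (biX_arr f) s
  (biX_seq w).
Proof.
move=> mf fw [|i] le; rewrite /biX_arr /biX_seq /= ?sgn0.
  by rewrite fw // /th !sgn0 /=; ring.
have T := monogenic_dint3 _ _ (~~ s) (n - i.+1)%N i 0 mf; rewrite negbK sgn_negb opprK in T.
rewrite (_ : dint k3 1 * _ = - sgn i * (dint k3 1 * f (~~ s) (n - i.+1)%N i 1%N)); last first.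
  by rewrite sgnS sgn0; ring.
have ni : (n - i.+1).+1 = (n - i)%N by lia.
rewrite T ni !fw ?(ltnW le) //= /th (_ : i.+1%:R = dint k2 i.+1 - k2 * (1 - sgn i.+1)); last
  first.
  by rewrite /dint; ring.
rewrite !sgnS; set h := 2%:R^-1; case: (sgn_or i) => ->; ring: im2.
Qed.

Lemma restricts_biY f s w : monogenic n f -> restricts f s w -> restricts (biY_arr f) s
  (biY_seq w).
Proof.
move=> mf fw i le; rewrite /biY_arr /biY_seq /= ?sgn0.
have -> : - sgn s * (im * (mulvar (fun a => dint k3 1 * (sgn a * (sgn 1 * f (~~ s) a i 1%N)))
  (n - i) - 0))
  = - sgn s * im * mulvar (fun a => dint k3 1 * (sgn a * (sgn 1 * f (~~ s) a i 1%N))) (n - i)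
    by ring.
have -> : mulvar (fun a => dint k3 1 * (sgn a * (sgn 1 * f (~~ s) a i 1%N))) (n - i) =
   sgn (n - i) * (sgn s * dint k1 (n - i) * f s (n - i)%N i 0%N)
    - sgn i * im * dint k2 i.+1 * ck_coef s i.+1 * w i.+1.
  (* At $i=n$ both terms on the right vanish: each contains [dint k1 0], the second one inside
     [ck_coef s i.+1]. *)
  case E : (n - i)%N => [|a]; rewrite /mulvar.
    by rewrite [ck_coef s _]/= E !dint0; ring.
  have T := monogenic_dint3 _ _ (~~ s) a i 0 mf; rewrite negbK sgn_negb opprK in T.
  rewrite (_ : dint k3 1 * _ = - sgn a * (dint k3 1 * f (~~ s) a i 1%N)); last first.
    by rewrite sgnS sgn0; ring.
  rewrite T [in f s a i.+1]((_ : a = (n - i.+1)%N)); last by lia.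
  have -> : sgn i = sgn a by rewrite -[RHS]opprK -sgnS -E sgnB ?opprK.
  rewrite sgnS (fw i.+1); last by lia.
  by ring.
rewrite fw // (mulrDr (ck_coef s i)) (mulrA _ (phiY _)) -ck_coef_im sgnB // /thetaY.
rewrite (_ : dint k1 (n - i) = n%:R - i%:R + k1 * (1 + sgn i)); last first.
  by rewrite /dint sgnB // natrB //; ring.
set h := 2%:R^-1; have es := sgn2 s.
by case: (sgn_or i) => ->; ring: im2 es.
Qed.

Lemma restricts_biZ f s w : monogenic n f -> restricts f s w -> restricts (biZ_arr f) s
  (biZ_seq w).
Proof.
move=> mf fw i le; rewrite /biZ_arr /biZ_seq /= ?sgn0.
have es := sgn2 s.
have -> : mulvar (fun b => dint k1 (n - i).+1 * (sgn (n - i).+1 * (sgn b * f s (n - i).+1 b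
  0%N))) i
   = ck_coef s i * - (im * sgn s) * mulvar (fun j => - sgn j * w j) i.
  case: i le => [|i] lt; rewrite /mulvar; first by rewrite mulr0.
  have -> : (n - i.+1).+1 = (n - i)%N by lia.
  rewrite fw ?sgnB; [|lia..].
  by rewrite [ck_coef s i.+1]/=; case: (sgn_or i) => ->; ring: im2 es.
have -> : mulvar (fun a => dint k2 i.+1 * (sgn a * (sgn i.+1 * f s a i.+1 0%N))) (n - i)
   = ck_coef s i.+1 * - dint k2 i.+1 * w i.+1.
  case E : (n - i)%N => [|a]; rewrite /mulvar.
    by rewrite [ck_coef s _]/= E !dint0; ring.
  have Ea : a = (n - i.+1)%N by lia.
  rewrite {2}Ea fw; last by lia.
  have -> : sgn a = sgn i by rewrite -[LHS]opprK -sgnS -E sgnB ?opprK.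
  by rewrite sgnS; case: (sgn_or i) => ->; ring.
have -> : ck_coef s i * ((sgn i * (k1 - k2) - 2%:R^-1) * w i +
     mulvar (fun j : nat => - sgn j * w j) i - sgn i * phiY i.+1 * w i.+1) =
   ck_coef s i * ((sgn i * (k1 - k2) - 2%:R^-1) * w i +
     mulvar (fun j : nat => - sgn j * w j) i) - sgn i * (ck_coef s i * phiY i.+1) * w i.+1 by
       ring.
rewrite -ck_coef_im fw // sgnB //; set h := 2%:R^-1; set p := mulvar _ _.
by case: (sgn_or i) => ->; ring: im2 es.
Qed.

(** Comparing tridiagonal entries identifies the geometric $Z$ with that of $E_n(a,b,c)$; the scalar
    is $c^2-a^2-b^2+(n+1)^2/4$. *)
Lemma biZ_seqE w i : (i <= n)%N ->
  biZ_seq w i = biX_seq (biY_seq w) i + biY_seq (biX_seq w) i -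
   ((k1 + k2 + n.+1%:R / 2%:R) ^+ 2 - (k2 + k3 + n.+1%:R / 2%:R) ^+ 2
     - (- k1 - k3 - n.+1%:R / 2%:R) ^+ 2 + n.+1%:R ^+ 2 / 4%:R) * w i.
Proof.
move=> le; rewrite /biZ_seq /biX_seq /biY_seq /th /thetaY.
have phiYE j : (j <= n.+1)%N -> phiY j = (j%:R + k2 * (1 - sgn j)) * (n.+1%:R - j%:R + k1 * (1
  - sgn j)).
  move=> lej; rewrite /phiY /dint natrB //.
  have -> // : sgn (n.+1 - j) = sgn j.
  by rewrite /sgn -signr_odd oddB //= n_odd addFb signr_odd.
have four_neq0 : 4%:R != 0 :> F by rewrite (natrM _ 2 2) mulf_neq0.
case: i le => [|i] le; rewrite /= ?phiYE ?sgnS ?sgn0; try lia.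
  by field; rewrite two_neq0 four_neq0.
by case: (sgn_or i) => ->; field; rewrite two_neq0 four_neq0.
Qed.

End Restriction.

(** * Existence of the extension from $x_3=0$ *)

Section Extension.
Variable n : nat.
Hypothesis k3_reg : forall j, (0 < j <= n)%N -> dint k3 j != 0.

(** [monogenic_dint3] read as a recursion on the exponent of $x_3$. The data [g] omit the exponent
    of $x_1$, which homogeneity fixes. *)
Fixpoint ck (g : bool -> nat -> F) (c : nat) (s : bool) (a b : nat) : F :=
  if c is c'.+1 then (dint k3 c)^-1 *
    (- sgn s * (dint k1 a.+1 * ck g c' (~~ s) a.+1 b) + im * (dint k2 b.+1 * ck g c' (~~ s) a
      b.+1))
  else g s b.

Definition ck_array g : array := fun s a b c => if (a + b + c == n)%N then ck g c s a b else 0.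

Lemma monogenic_ck g : monogenic n (ck_array g).
Proof.
split=> s a b c; first by rewrite /ck_array => /negPf->.
rewrite /dirac_arr /ck_array !addnS !addSn.
case: eqP => [E|_]; last by rewrite !mulr0 !addr0.
have c_n : (0 < c.+1 <= n)%N by lia.
rewrite [ck g c.+1 _ _ _]/= mulVKf ?k3_reg //.
by have := sgn2 s; move: (sgn s) => e es; ring: es.
Qed.

End Extension.

End CoefficientArrays.

(** * Coefficients of polynomial spinors *)

Section PairCoefficients.
Variable R : realType.
Implicit Types (p q : Pol R) (a b c i : nat).

Definition mnm3 a b c : 'X_{1..3} := [multinom tnth [tuple a; b; c] j | j < 3].

Lemma ord3P (P : 'I_3 -> Prop) : P i1 -> P i2 -> P i3 -> forall j, P j.
Proof.
move=> P1 P2 P3 [[|[|[|//]]] h].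
- by rewrite (_ : Ordinal h = i1) //; apply: val_inj.
- by rewrite (_ : Ordinal h = i2) //; apply: val_inj.
- by rewrite (_ : Ordinal h = i3) //; apply: val_inj.
Qed.

Lemma mnm3_1 a b c : mnm3 a b c i1 = a. Proof. by rewrite mnmE. Qed.
Lemma mnm3_2 a b c : mnm3 a b c i2 = b. Proof. by rewrite mnmE. Qed.
Lemma mnm3_3 a b c : mnm3 a b c i3 = c. Proof. by rewrite mnmE. Qed.
Definition mnm3K := (mnm3_1, mnm3_2, mnm3_3).

Lemma mnm3E (m : 'X_{1..3}) : m = mnm3 (m i1) (m i2) (m i3).
Proof. by apply/mnmP; apply: ord3P; rewrite mnm3K. Qed.

Lemma mdeg_mnm3 a b c : mdeg (mnm3 a b c) = (a + b + c)%N.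
Proof. by rewrite mdegE !big_ord_recl big_ord0 !mnmE /= addn0 addnA. Qed.

Lemma mnm3S1 a b c : (mnm3 a b c + U_(i1))%MM = mnm3 a.+1 b c.
Proof. by apply/mnmP; apply: ord3P; rewrite mnmDE mnm1E !mnm3K ?addn0 ?addn1. Qed.
Lemma mnm3S2 a b c : (mnm3 a b c + U_(i2))%MM = mnm3 a b.+1 c.
Proof. by apply/mnmP; apply: ord3P; rewrite mnmDE mnm1E !mnm3K ?addn0 ?addn1. Qed.
Lemma mnm3S3 a b c : (mnm3 a b c + U_(i3))%MM = mnm3 a b c.+1.
Proof. by apply/mnmP; apply: ord3P; rewrite mnmDE mnm1E !mnm3K ?addn0 ?addn1. Qed.

Lemma mcoeff_refl (j : 'I_3) p (m : 'X_{1..3}) : (refl j p)@_m = (-1) ^+ (m j) * p@_m.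
Proof.
rewrite /refl comp_mpolyE raddf_sum /=.
rewrite [in RHS](mpolyE p) raddf_sum /= mulr_sumr; apply: eq_bigr => m' _.
have -> : \prod_(i < 3) tnth [tuple (if l == j then - 'X_l else 'X_l) | l < 3] i ^+ m' i
   = (-1) ^+ (m' j) *: 'X_[m'] :> Pol R.
  rewrite mpolyXE_id (bigD1 j) //= [in RHS](bigD1 j) //= tnth_mktuple eqxx.
  rewrite scalerAl; congr (_ * _).
    by rewrite [LHS]exprNn -(signr_odd (Pol R)) -[in RHS]signr_odd scaler_sign; case: odd;
      rewrite ?mulN1r ?mul1r.
  by apply: eq_bigr => i /negPf ne; rewrite tnth_mktuple ne.
rewrite !mcoeffZ mcoeffX; case: eqP => [->|_]; last by rewrite !mulr0.
by rewrite !mulr1 mulrC.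
Qed.

Lemma mcoeff_mdivX (j : 'I_3) p m : (mdivX j p)@_m = p@_(m + U_(j)).
Proof.
rewrite /mdivX raddf_sum /= [in RHS](mpolyE p) raddf_sum /= big_mkcond /=.
apply: eq_bigr => m' _; rewrite [RHS]mcoeffZ [in RHS]mcoeffX.
case: eqP => [->|ne].
  by rewrite mnmDE mnm1E eqxx addn1 /= mcoeffZ mcoeffX addmK eqxx.
case: ifP => m'j; rewrite ?mulr0 ?mcoeff0 // mcoeffZ mcoeffX; case: eqP => E; rewrite ?mulr0
  //; case: ne.
by rewrite -E submK //; apply/mnm_lepP => l; rewrite mnm1E; case: eqP => [<-|].
Qed.

Lemma mcoeff_dunkl k (j : 'I_3) p m : (dunkl k j p)@_m = dint _ (rC k) (m j).+1 * p@_(m + U_(j)).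
Proof.
rewrite mcoeffD mcoeffZ mcoeff_mdivX mcoeffB mcoeff_refl mcoeff_deriv.
by rewrite mnmDE mnm1E eqxx addn1 /dint /sgn exprS -mulr_natl; ring.
Qed.

Lemma mcoeff_mulX (j : 'I_3) p m :
  ('X_j * p)@_m = if (0 < m j)%N then p@_(m - U_(j)) else 0.
Proof.
rewrite -(commr_mpolyX _ p); case: ifP => mj.
  have le_jm : (U_(j) <= m)%MM.
    by apply/mnm_lepP => l; rewrite mnm1E; case: eqP => [<-|].
  by rewrite -{1}(submK le_jm) addmC mcoeffMX.
rewrite {1}(mpolyE p) mulr_suml raddf_sum /= big1 // => m' _.
rewrite -scalerAl mcoeffZ -mpolyXD mcoeffX; case: eqP => [E|]; last by rewrite mulr0.
by move: mj; rewrite -E mnmDE mnm1E eqxx addn1.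
Qed.

Implicit Types u v : Pair R.

Definition coef u : array (complex R) := fun s a b c => (if s then u.2 else u.1)@_(mnm3 a b c).

Lemma coef_inj u v : (forall s a b c, coef u s a b c = coef v s a b c) -> u = v.
Proof.
case: u v => [p q] [p' q'] h; congr (_, _); apply/mpolyP => m; rewrite [m]mnm3E.
  exact: (h false).
exact: (h true).
Qed.

(** Each [rep_] lemma below computes one elementary operator; composite operators follow by
    composing these proof terms. *)
Definition represents u (f : array (complex R)) := forall s a b c, coef u s a b c = f s a b c.

Lemma rep_add u v f g : represents u f -> represents v g ->
  represents (addP u v) (fun s a b c => f s a b c + g s a b c).
Proof. by move=> uf vg s a b c; rewrite -uf -vg; case: s; exact: mcoeffD. Qed.

Lemma rep_sub u v f g : represents u f -> represents v g ->
  represents (subP u v) (fun s a b c => f s a b c - g s a b c).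
Proof. by move=> uf vg s a b c; rewrite -uf -vg; case: s; exact: mcoeffB. Qed.

Lemma rep_scale x u f : represents u f ->
  represents (scaleP x u) (fun s a b c => x * f s a b c).
Proof. by move=> uf s a b c; rewrite -uf; case: s; exact: mcoeffZ. Qed.

Lemma rep_sig1 u f : represents u f -> represents (sig1 u) (fun s a b c => f (~~ s) a b c).
Proof. by move=> uf s a b c; rewrite -uf; case: s. Qed.

Lemma rep_sig2 u f : represents u f ->
  represents (sig2 u) (fun s a b c => - sgn _ s * ('i * f (~~ s) a b c)).
Proof.
move=> uf s a b c; rewrite -uf.
case: s; rewrite /sgn /= ?expr0 ?expr1 ?opprK ?mul1r ?mulN1r; first exact: mcoeffZ.
by apply: (etrans (mcoeffN _ _)); congr (- _); exact: mcoeffZ.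
Qed.

Lemma rep_sig3 u f : represents u f -> represents (sig3 u) (fun s a b c => sgn _ s * f s a b c).
Proof.
move=> uf s a b c; rewrite -uf.
by case: s; rewrite /sgn /= ?expr0 ?expr1 ?mul1r ?mulN1r //; exact: mcoeffN.
Qed.

Lemma rep_R1 u f : represents u f -> represents (Rp i1 u) (fun s a b c => sgn _ a * f s a b c).
Proof.
by move=> uf s a b c; rewrite -uf; case: s; apply: (etrans (mcoeff_refl _ _ _)); rewrite mnm3K.
Qed.

Lemma rep_T1 k u f : represents u f ->
  represents (Tp k i1 u) (fun s a b c => dint _ (rC k) a.+1 * f s a.+1 b c).
Proof.
move=> uf s a b c; rewrite -uf.
by case: s; apply: (etrans (mcoeff_dunkl _ _ _ _)); rewrite mnm3K mnm3S1.
Qed.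

Lemma rep_X1 u f : represents u f ->
  represents (Xp i1 u) (fun s a b c => mulvar _ (fun a => f s a b c) a).
Proof.
move=> uf s a b c.
have -> : mulvar _ (fun a => f s a b c) a = mulvar _ (fun a => coef u s a b c) a by case: a =>
  //= a; rewrite uf.
case: s; apply: (etrans (mcoeff_mulX _ _ _)); rewrite mnm3K; case: a => [|a].
1,3: reflexivity.
all: by rewrite -mnm3S1 addmK.
Qed.

Lemma rep_R2 u f : represents u f -> represents (Rp i2 u) (fun s a b c => sgn _ b * f s a b c).
Proof.
by move=> uf s a b c; rewrite -uf; case: s; apply: (etrans (mcoeff_refl _ _ _)); rewrite mnm3K.
Qed.

Lemma rep_T2 k u f : represents u f ->
  represents (Tp k i2 u) (fun s a b c => dint _ (rC k) b.+1 * f s a b.+1 c).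
Proof.
move=> uf s a b c; rewrite -uf.
by case: s; apply: (etrans (mcoeff_dunkl _ _ _ _)); rewrite mnm3K mnm3S2.
Qed.

Lemma rep_X2 u f : represents u f ->
  represents (Xp i2 u) (fun s a b c => mulvar _ (fun b => f s a b c) b).
Proof.
move=> uf s a b c.
have -> : mulvar _ (fun b => f s a b c) b = mulvar _ (fun b => coef u s a b c) b by case: b =>
  //= b; rewrite uf.
case: s; apply: (etrans (mcoeff_mulX _ _ _)); rewrite mnm3K; case: b => [|b].
1,3: reflexivity.
all: by rewrite -mnm3S2 addmK.
Qed.

Lemma rep_R3 u f : represents u f -> represents (Rp i3 u) (fun s a b c => sgn _ c * f s a b c).
Proof.
by move=> uf s a b c; rewrite -uf; case: s; apply: (etrans (mcoeff_refl _ _ _)); rewrite mnm3K.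
Qed.

Lemma rep_T3 k u f : represents u f ->
  represents (Tp k i3 u) (fun s a b c => dint _ (rC k) c.+1 * f s a b c.+1).
Proof.
move=> uf s a b c; rewrite -uf.
by case: s; apply: (etrans (mcoeff_dunkl _ _ _ _)); rewrite mnm3K mnm3S3.
Qed.

Lemma rep_X3 u f : represents u f ->
  represents (Xp i3 u) (fun s a b c => mulvar _ (fun c => f s a b c) c).
Proof.
move=> uf s a b c.
have -> : mulvar _ (fun c => f s a b c) c = mulvar _ (fun c => coef u s a b c) c by case: c =>
  //= c; rewrite uf.
case: s; apply: (etrans (mcoeff_mulX _ _ _)); rewrite mnm3K; case: c => [|c].
1,3: reflexivity.
all: by rewrite -mnm3S3 addmK.
Qed.

(** * Coefficients of the Dirac operator and of $X$, $Y$, $Z$ *)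

Section Operators.
Variables k1 k2 k3 : R.

Lemma rep_Dirac u f : represents u f ->
  represents (Dirac k1 k2 k3 u) (dirac_arr _ 'i (rC k1) (rC k2) (rC k3) f).
Proof.
move=> h; exact: (rep_add _ _ _ _ (rep_sig1 _ _ (rep_T1 k1 _ _ h))
  (rep_add _ _ _ _ (rep_sig2 _ _ (rep_T2 k2 _ _ h)) (rep_sig3 _ _ (rep_T3 k3 _ _ h)))).
Qed.

Lemma rep_BIX u f : represents u f ->
  represents (BIX k1 k2 k3 u) (biX_arr _ 'i (rC k2) (rC k3) f).
Proof.
move=> h; have hv := rep_R2 _ _ (rep_R3 _ _ h).
exact: (rep_add _ _ _ _
  (rep_add _ _ _ _
    (rep_scale 'i _ _ (rep_sig1 _ _ (rep_sub _ _ _ _ (rep_X3 _ _ (rep_T2 k2 _ _ hv)) (rep_X2 _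
      _ (rep_T3 k3 _ _ hv)))))
    (rep_scale (Defs.half R) _ _ hv))
  (rep_add _ _ _ _ (rep_scale (rC k2) _ _ (rep_R3 _ _ h)) (rep_scale (rC k3) _ _ (rep_R2 _ _
    h)))).
Qed.

Lemma rep_BIY u f : represents u f ->
  represents (BIY k1 k2 k3 u) (biY_arr _ 'i (rC k1) (rC k3) f).
Proof.
move=> h; have hv := rep_R1 _ _ (rep_R3 _ _ h).
exact: (rep_add _ _ _ _
  (rep_add _ _ _ _
    (rep_scale 'i _ _ (rep_sig2 _ _ (rep_sub _ _ _ _ (rep_X1 _ _ (rep_T3 k3 _ _ hv)) (rep_X3 _
      _ (rep_T1 k1 _ _ hv)))))
    (rep_scale (Defs.half R) _ _ hv))
  (rep_add _ _ _ _ (rep_scale (rC k3) _ _ (rep_R1 _ _ h)) (rep_scale (rC k1) _ _ (rep_R3 _ _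
    h)))).
Qed.

Lemma rep_BIZ u f : represents u f ->
  represents (BIZ k1 k2 k3 u) (biZ_arr _ 'i (rC k1) (rC k2) f).
Proof.
move=> h; have hv := rep_R1 _ _ (rep_R2 _ _ h).
exact: (rep_add _ _ _ _
  (rep_add _ _ _ _
    (rep_scale 'i _ _ (rep_sig3 _ _ (rep_sub _ _ _ _ (rep_X2 _ _ (rep_T1 k1 _ _ hv)) (rep_X1 _
      _ (rep_T2 k2 _ _ hv)))))
    (rep_scale (Defs.half R) _ _ hv))
  (rep_add _ _ _ _ (rep_scale (rC k1) _ _ (rep_R2 _ _ h)) (rep_scale (rC k2) _ _ (rep_R1 _ _
    h)))).
Qed.

End Operators.
End PairCoefficients.

(** * Bidiagonal matrices and the modules E_d(a, b, c) *)

Section Coordinates.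
Variables (F : fieldType) (d : nat).
Implicit Types (w : 'cV[F]_d.+1) (f g : nat -> F).

(** Beyond [d], [inord] falls back to index 0, so [coord w d.+1] is a meaningless value that must
    meet a zero factor. *)
Definition coord w (i : nat) : F := w (inord i) 0.

Lemma coord_eq w w' : (forall i, (i <= d)%N -> coord w i = coord w' i) -> w = w'.
Proof.
move=> h; apply/matrixP => i j; rewrite ord1.
by have := h i (leq_ord i); rewrite /coord inord_val.
Qed.

Lemma inord_eq i j : (i <= d)%N -> (j <= d)%N -> (inord i == inord j :> 'I_d.+1) = (i == j).
Proof. by move=> li lj; rewrite -val_eqE /= !inordK. Qed.

Lemma coord_col f i : (i <= d)%N -> coord (\col_j f j) i = f i.
Proof. by move=> le; rewrite /coord mxE inordK. Qed.

Lemma coord0 i : coord 0 i = 0. Proof. by rewrite /coord mxE. Qed.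
Lemma coordD w w' i : coord (w + w') i = coord w i + coord w' i. Proof. by rewrite /coord mxE.
  Qed.
Lemma coordB w w' i : coord (w - w') i = coord w i - coord w' i. Proof. by rewrite /coord !mxE.
  Qed.
Lemma coordZ x w i : coord (x *: w) i = x * coord w i. Proof. by rewrite /coord mxE. Qed.

Definition lower_bidiag (th : nat -> F) : 'M[F]_d.+1 :=
  \matrix_(i, j) (if i == j then th i else if (i == j.+1 :> nat) then 1 else 0).

Definition upper_bidiag (th phiY : nat -> F) : 'M[F]_d.+1 :=
  \matrix_(i, j) (if i == j then th i else if (j == i.+1 :> nat) then phiY j else 0).

Lemma coord_lower th w i : (i <= d)%N ->
  coord (lower_bidiag th *m w) i = th i * coord w i + mulvar _ (coord w) i.
Proof.
move=> le; rewrite /coord mxE (bigD1 (inord i)) //= mxE eqxx inordK //; congr (_ + _).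
case: i le => [|i] le /=.
  apply: big1 => j ne; rewrite mxE eq_sym (negPf ne) inordK //= mul0r //.
rewrite (bigD1 (inord i)) /=; last by rewrite inord_eq ?ltn_eqF // ltnW.
have li : (i < d.+1)%N by exact: ltnW.
rewrite mxE inord_eq ?(ltnW le) // gtn_eqF // !inordK // eqxx mul1r.
rewrite big1 ?addr0 // => j /andP[n1 n2]; rewrite mxE eq_sym (negPf n1) inordK //.
case: eqP => [[e]|]; last by rewrite mul0r.
by case/eqP: n2; apply: val_inj; rewrite /= inordK // ltnW.
Qed.

Lemma coord_upper th phiY ph' w i : (i <= d)%N ->
  (forall j, (0 < j <= d)%N -> ph' j = phiY j) -> ph' d.+1 = 0 ->
  coord (upper_bidiag th phiY *m w) i = th i * coord w i + ph' i.+1 * coord w i.+1.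
Proof.
move=> le hph hd; rewrite /coord mxE (bigD1 (inord i)) //= mxE eqxx inordK //; congr (_ + _).
move: le; rewrite leq_eqVlt => /orP[/eqP e|lt].
  rewrite e hd mul0r; apply: big1 => j ne; have li : (i < d.+1)%N by rewrite e.
  by rewrite mxE eq_sym (negPf ne) inordK // ltn_eqF ?mul0r // e ltn_ord.
rewrite (bigD1 (inord i.+1)) /=; last by rewrite inord_eq ?gtn_eqF // ltnW.
have li : (i < d.+1)%N by exact: ltnW.
rewrite mxE inord_eq ?(ltnW lt) // ltn_eqF // !inordK // eqxx hph //.
rewrite big1 ?addr0 // => j /andP[n1 n2]; rewrite mxE eq_sym (negPf n1) inordK //.
case: eqP => [e|]; last by rewrite mul0r.
by case/eqP: n2; apply: val_inj; rewrite /= inordK.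
Qed.

Definition unitv (j : nat) : 'cV[F]_d.+1 := delta_mx (inord j) 0.

Lemma coord_unitv j i : (j <= d)%N -> (i <= d)%N -> coord (unitv j) i = (i == j)%:R.
Proof. by move=> lj li; rewrite /coord mxE eqxx andbT inord_eq. Qed.

Lemma mx_eq_unitv (A B : 'M[F]_d.+1) : (forall j, (j <= d)%N -> A *m unitv j = B *m unitv j) ->
  A = B.
Proof.
move=> h; apply/matrixP => i j; have := h j (leq_ord j).
by rewrite /unitv inord_val -!colE => /matrixP/(_ i 0); rewrite !mxE.
Qed.

Lemma lower_unitv th j : (j < d)%N -> lower_bidiag th *m unitv j = th j *: unitv j + unitv j.+1.
Proof.
move=> lt; apply: coord_eq => i le; rewrite coord_lower // coordD coordZ !coord_unitv ?(ltnW
  lt) //.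
have -> : mulvar _ (coord (unitv j)) i = (i == j.+1)%:R.
  by case: i le => [|i] le //=; rewrite coord_unitv // ltnW.
by case: (altP (i =P j)) => [->|_] //; rewrite !mulr0.
Qed.

Lemma lower_unitv_last th : lower_bidiag th *m unitv d = th d *: unitv d.
Proof.
apply: coord_eq => i le; rewrite coord_lower // coordZ !coord_unitv //.
have -> : mulvar _ (coord (unitv d)) i = 0.
  by case: i le => [|i] le //=; rewrite coord_unitv ?ltn_eqF // ltnW.
by rewrite addr0; case: (altP (i =P d)) => [->|_] //; rewrite !mulr0.
Qed.

End Coordinates.

(** * $X$ and $Y$ as operators on sequences, and an eigenvector of $Y$ *)

Section SplitModule.
Variables (F : fieldType) (a b c : F) (d : nat).
Hypothesis d_odd : odd d.
Hypothesis two_neq0 : 2%:R != 0 :> F.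

Definition theta (x : F) (i : nat) : F := (-1) ^+ i * (2%:R * x - d%:R + 2%:R * i%:R) / 2%:R.

Definition vphi (y : F) (i : nat) : F :=
  if ~~ odd i then (i * (d - i + 1))%N%:R
  else c ^+ 2 - (2%:R * a + 2%:R * y - d%:R + 2%:R * i%:R - 1) ^+ 2 / 4%:R.

(* Unlike [vphi], whose truncated subtraction gives [d.+1] at [d.+1], this
   version vanishes there, so [seqY] needs no boundary case at the last coordinate. *)
Definition vphi' (y : F) (i : nat) : F :=
  if ~~ odd i then i%:R * (d%:R + 1 - i%:R)
  else c ^+ 2 - (2%:R * a + 2%:R * y - d%:R + 2%:R * i%:R - 1) ^+ 2 / 4%:R.

Lemma vphi'E y i : (0 < i <= d)%N -> vphi' y i = vphi y i.
Proof.
move=> /andP[_ le]; rewrite /vphi /vphi'; case: ifP => // _.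
by rewrite natrM natrD natrB //; ring.
Qed.

Lemma vphi'_last y : vphi' y d.+1 = 0.
Proof. by rewrite /vphi' /= d_odd /=; ring. Qed.

Definition seqX (f : nat -> F) i := theta a i * f i + mulvar F f i.
Definition seqY y (f : nat -> F) i := theta y i * f i + vphi' y i.+1 * f i.+1.

Local Notation kappa := (c ^+ 2 - a ^+ 2 - b ^+ 2 + d.+1%:R ^+ 2 / 4%:R).
Local Notation mu := (b ^+ 2 - a ^+ 2 - c ^+ 2 + d.+1%:R ^+ 2 / 4%:R).

Lemma four_neq0 : 4%:R != 0 :> F.
Proof. by rewrite (natrM _ 2 2) mulf_neq0. Qed.

(** Eliminating $Z=\{X,Y\}-\kappa$ from $\{Z,X\}=Y+\mu$ gives this relation, linear in $Y$. *)
Lemma seq_relation f i :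
  seqX (seqX (seqY b f)) i + seqX (seqY b (seqX f)) i *+ 2 + seqY b (seqX (seqX f)) i
  = 2%:R * kappa * seqX f i + seqY b f i + mu * f i.
Proof.
have sg j : (-1) ^+ j = (if odd j then -1 else 1) :> F by rewrite -signr_odd; case: odd.
(* Two applications of $X$ reach back two places, so the first two coordinates are treated apart. *)
case: i => [|[|i]]; rewrite /seqX /seqY /mulvar /theta /vphi' !sg /=.
- by field; rewrite four_neq0 two_neq0.
- by field; rewrite four_neq0 two_neq0.
by case: (odd i) => /=; field; rewrite four_neq0 two_neq0.
Qed.

(* The eigenvector of Y for the last diagonal entry, normalized by [Yeig 0 = 1]. *)
Fixpoint Yeig (i : nat) : F :=
  if i is j.+1 then Yeig j * (theta b d - theta b j) / vphi' b i else 1.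

Hypothesis vphi_neq0 : forall i, (0 < i <= d)%N -> vphi b i != 0.

(** The recursion of [Yeig] cleared of its denominator; at $i=d$ both sides vanish. *)
Lemma YeigS i : (i <= d)%N -> vphi' b i.+1 * Yeig i.+1 = Yeig i * (theta b d - theta b i).
Proof.
rewrite leq_eqVlt => /orP[/eqP->|lt]; first by rewrite vphi'_last mul0r subrr mulr0.
by rewrite /= mulrC divfK // vphi'E ?vphi_neq0.
Qed.

(** As $d$ is odd, the last diagonal entry $-(2b+d)/2$ of $Y_b$ is the first one of $Y_{-b}$: [Yeig]
    behaves under $Y_b$ as $v_0$ does under $Y_{-b}$. *)
Lemma seqY_Yeig i : (i <= d)%N -> seqY b Yeig i = theta (- b) 0 * Yeig i.
Proof.
move=> le; rewrite /seqY YeigS //.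
have -> : theta (- b) 0 = theta b d.
  by rewrite /theta -[(-1) ^+ d]signr_odd d_odd; ring.
by ring.
Qed.

(** The vector $(X-\theta_0)q$ behaves under $Y_b$ as $v_1$ does under $Y_{-b}$. *)
Lemma seqY_step i : (i <= d)%N ->
  seqY b (fun i => seqX Yeig i - theta a 0 * Yeig i) i
  = theta (- b) 1 * (seqX Yeig i - theta a 0 * Yeig i) + vphi' (- b) 1 * Yeig i.
Proof.
move=> le; rewrite /seqY /seqX.
have -> : vphi' b i.+1 * (theta a i.+1 * Yeig i.+1 + mulvar F Yeig i.+1 - theta a 0 * Yeig i.+1)
   = (theta a i.+1 - theta a 0) * (vphi' b i.+1 * Yeig i.+1) + vphi' b i.+1 * Yeig i.
  by rewrite [mulvar _ _ _]/=; ring.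
rewrite YeigS //.
have sg j : (-1) ^+ j = (if odd j then -1 else 1) :> F by rewrite -signr_odd; case: odd.
case: i le => [|i] le.
  by rewrite /theta /vphi' /= !sg d_odd /=; field; rewrite four_neq0 two_neq0.
have ne : vphi' b i.+1 != 0 by rewrite vphi'E ?vphi_neq0.
apply: (mulfI ne); rewrite [mulvar _ _ _]/=.
have E := YeigS i (ltnW le); move: ne E; set v := vphi' b i.+1; set Q := Yeig i.+1 => ne E.
(* After multiplication by [v], eliminating [v * Q] through [E] leaves [Yeig i] times this
   expression as the difference of the two sides. *)
have K : (theta b i.+1 - theta (- b) 1) * ((theta a i.+1 - theta a 0) * (theta b d - theta b i)
  + v)
    + (theta b d - theta b i) * ((theta a i.+2 - theta a 0) * (theta b d - theta b i.+1)
    + vphi' b i.+2 - vphi' (- b) 1) = 0.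
  rewrite /v /theta /vphi' !sg /= d_odd.
  by case: (odd i) => /=; field; rewrite four_neq0 two_neq0.
apply/eqP; rewrite -subr_eq0 -[0](mulr0 (Yeig i)) -K; apply/eqP; ring: E.
Qed.

Local Notation X := (lower_bidiag F d (theta a)).
Local Notation Y y := (upper_bidiag F d (theta y) (vphi y)).

Definition agree (f g : nat -> F) := forall i, (i <= d)%N -> f i = g i.

Lemma seqX_agree f g : agree f g -> agree (seqX f) (seqX g).
Proof.
move=> h [|i] le; rewrite /seqX /mulvar ?h //.
exact: ltnW.
Qed.

Lemma seqY_agree y f g : agree f g -> agree (seqY y f) (seqY y g).
Proof.
move=> h i; rewrite /seqY leq_eqVlt => /orP[/eqP->|lt].
  by rewrite vphi'_last !mul0r h.
by rewrite !h // ltnW.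
Qed.

Lemma coord_mulX w : agree (coord F d (X *m w)) (seqX (coord F d w)).
Proof. by move=> i le; rewrite coord_lower. Qed.

Lemma coord_mulY y w : agree (coord F d (Y y *m w)) (seqY y (coord F d w)).
Proof.
move=> i le; rewrite (coord_upper _ _ _ _ (vphi' y)) //; first exact: vphi'E.
exact: vphi'_last.
Qed.

(** The double anticommutator $\{X,\{X,M\}\}$. *)
Definition anticomm2 (M : 'M[F]_d.+1) :=
  X *m X *m M + (X *m M *m X + X *m M *m X) + M *m X *m X.

End SplitModule.

(** * The relation linear in $Y$, for matrices *)

Section Relation.
Variables (F : fieldType) (a b c : F) (d : nat).
Hypothesis d_odd : odd d.
Hypothesis two_neq0 : 2%:R != 0 :> F.
Local Notation X := (lower_bidiag F d (theta F d a)).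
Local Notation Y y := (upper_bidiag F d (theta F d y) (vphi F a c d y)).

Lemma bidiag_relation y :
  anticomm2 F a d (Y y) =
    (2%:R * (c ^+ 2 - a ^+ 2 - y ^+ 2 + d.+1%:R ^+ 2 / 4%:R)) *: X + Y y
     + (y ^+ 2 - a ^+ 2 - c ^+ 2 + d.+1%:R ^+ 2 / 4%:R)%:M.
Proof.
apply: mx_eq_unitv => j _; set w := unitv F d j.
rewrite /anticomm2 !mulmxDl -scalemxAl mul_scalar_mx -!mulmxA.
apply: coord_eq => i le; rewrite !coordD !coordZ.
set f := coord F d w.
have hX := coord_mulX F a d; have hY := coord_mulY F a c d d_odd y.
have agX := seqX_agree F a d; have agY := seqY_agree F a c d d_odd y.
have -> : coord F d (X *m (X *m (Y y *m w)) ) i = seqX F a d (seqX F a d (seqY F a c d y f)) i.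
  by rewrite hX //; apply: (agX) le => k lk; rewrite hX //; apply: (agX) lk => l ll; exact: hY.
have -> : coord F d (X *m (Y y *m (X *m w)) ) i = seqX F a d (seqY F a c d y (seqX F a d f)) i.
  by rewrite hX //; apply: (agX) le => k lk; rewrite hY //; apply: (agY) lk => l ll; exact: hX.
have -> : coord F d (Y y *m (X *m (X *m w)) ) i = seqY F a c d y (seqX F a d (seqX F a d f)) i.
  by rewrite hY //; apply: (agY) le => k lk; rewrite hX //; apply: (agX) lk => l ll; exact: hX.
by rewrite -mulr2n seq_relation // hX // hY.
Qed.

Lemma anticomm2B M N : anticomm2 F a d (M - N) = anticomm2 F a d M - anticomm2 F a d N.
Proof.
rewrite /anticomm2 !mulmxBr !mulmxBl.
move: (X *m X *m M) (X *m X *m N) (X *m M *m X) (X *m N *m X) (M *m X *m X) (N *m X *m X).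
by move=> A A' B B' C C'; apply/matrixP => i j; rewrite !mxE; ring.
Qed.

(** On $w$ the terms $X^2M$ and $XMX$ vanish, which leaves $MX^2w=Mw=0$. *)
Lemma anticomm2_fix M (w : 'cV_d.+1) : anticomm2 F a d M = M ->
  M *m w = 0 -> M *m (X *m w) = 0 -> M *m (X *m (X *m w)) = 0.
Proof.
move=> /(congr1 (mulmx^~ w)) /= H M0 M1; move: H.
by rewrite /anticomm2 !mulmxDl -!mulmxA M0 M1 !mulmx0 !add0r.
Qed.

End Relation.

Lemma invmx_intertwine (F : fieldType) n (A B P : 'M[F]_n) : P \in unitmx ->
  A *m P = P *m B -> invmx P *m A = B *m invmx P.
Proof. by move=> U E; rewrite -[LHS](mulmxK U) -(mulmxA (invmx P)) E mulmxA mulVmx // mul1mx. Qed.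

(** * The flip from $b$ to $-b$, and irreducibility *)

Section Flip.
Variables (F : fieldType) (a b c : F) (d : nat).
Hypothesis d_odd : odd d.
Hypothesis two_neq0 : 2%:R != 0 :> F.
Hypothesis vphi_neq0 : forall y i, (y == b) || (y == - b) -> (0 < i <= d)%N -> vphi F a c d y i
  != 0.

Local Notation th := (theta F d a).
Local Notation X := (lower_bidiag F d th).
Local Notation Y y := (upper_bidiag F d (theta F d y) (vphi F a c d y)).
Local Notation q := (Yeig F a b c d).

(** Images of the basis vectors under the flip: the recursion copies $v_{j+1}=(X-\theta_j)v_j$. *)
Fixpoint krylov (j : nat) : 'cV[F]_d.+1 :=
  if j is k.+1 then X *m krylov k - th k *: krylov k else \col_i q i.

Definition flip : 'M[F]_d.+1 := \matrix_(i, j) krylov j i 0.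

Lemma flip_unitv j : (j <= d)%N -> flip *m unitv F d j = krylov j.
Proof.
by move=> le; rewrite /unitv -colE; apply/colP => i; rewrite !mxE inordK.
Qed.

Lemma coord_krylovS j i : (i <= d)%N ->
  coord F d (krylov j.+1) i = (th i - th j) * coord F d (krylov j) i + mulvar F (coord F d
    (krylov j)) i.
Proof. by move=> le; rewrite coordB coordZ coord_lower //; ring. Qed.

(** $X-\theta_j$ is lower triangular with zero $j$-th diagonal entry, so each step clears one more
    coordinate. *)
Lemma coord_krylov_lt j i : (i <= d)%N -> (i < j)%N -> coord F d (krylov j) i = 0.
Proof.
elim: j i => // j IH i le lt; rewrite coord_krylovS //.
have -> : mulvar F (coord F d (krylov j)) i = 0.
  by case: i le lt => [|i] le lt //=; rewrite IH // ltnW.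
move: lt; rewrite ltnS leq_eqVlt => /orP[/eqP->|lt]; first by rewrite subrr mul0r addr0.
by rewrite IH // mulr0 addr0.
Qed.

Lemma mulX_krylov j : X *m krylov j = th j *: krylov j + krylov j.+1.
Proof. by rewrite /= addrC subrK. Qed.

Lemma X_flip : X *m flip = flip *m X.
Proof.
apply: mx_eq_unitv => j; rewrite -!mulmxA leq_eqVlt => /orP[/eqP->|lt].
  (* At $j=d$ the chain closes up because [krylov d.+1] is zero. *)
  rewrite lower_unitv_last -scalemxAr !flip_unitv // mulX_krylov -[RHS]addr0; congr (_ + _).
  by apply: coord_eq => i le; rewrite coord_krylov_lt // coord0.
by rewrite lower_unitv // mulmxDr -scalemxAr !flip_unitv ?(ltnW lt) // mulX_krylov.
Qed.

Let D := Y b *m flip - flip *m Y (- b).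

(** Since [flip] commutes with $X$, both products satisfy [bidiag_relation] with the same $X$-term
    and scalar term, as these depend on $b^2$ only; they cancel in the difference. *)
Lemma anticomm2_D : anticomm2 F a d D = D.
Proof.
have XX_flip : X *m X *m flip = flip *m X *m X by rewrite -mulmxA X_flip mulmxA X_flip.
have commL M : anticomm2 F a d (M *m flip) = anticomm2 F a d M *m flip.
  by rewrite /anticomm2 !mulmxDl -!mulmxA [X *m (X *m flip)]mulmxA XX_flip -!mulmxA X_flip.
have commR M : anticomm2 F a d (flip *m M) = flip *m anticomm2 F a d M.
  by rewrite /anticomm2 !mulmxDr !mulmxA XX_flip X_flip.
rewrite anticomm2B commL commR !bidiag_relation // !mulmxDl !mulmxDr sqrrN.
rewrite -!scalemxAl -!scalemxAr X_flip scalar_mxC /D.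
move: (Y b *m flip) (flip *m Y _) (_ *: (flip *m X)) (_%:M *m flip) => A B C E.
by apply/matrixP => i j; rewrite !mxE; ring.
Qed.

Let d_gt0 : (0 < d)%N := odd_gt0 d_odd.

Lemma Y_unitv0 y : Y y *m unitv F d 0 = theta F d y 0 *: unitv F d 0.
Proof.
apply: coord_eq => i le; rewrite coord_mulY // coordZ /seqY coord_unitv //.
move: le; rewrite leq_eqVlt => /orP[/eqP->|lt]; last first.
  by case: i lt => [|i] lt; rewrite coord_unitv //= !mulr0 ?addr0.
by rewrite vphi'_last // mul0r addr0 eqn0Ngt d_gt0 !mulr0.
Qed.

Lemma Y_unitvS y j : (j < d)%N ->
  Y y *m unitv F d j.+1 = theta F d y j.+1 *: unitv F d j.+1 + vphi' F a c d y j.+1 *: unitv F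
    d j.
Proof.
move=> lt; apply: coord_eq => i le; rewrite coord_mulY // coordD !coordZ /seqY (coord_unitv _ _
  j.+1 i) // (coord_unitv _ _ j i) ?(ltnW lt) //.
have -> : theta F d y i * (i == j.+1)%:R = theta F d y j.+1 * (i == j.+1)%:R.
  by case: (altP (i =P j.+1)) => [->|_] //; rewrite !mulr0.
congr (_ + _); move: le; rewrite leq_eqVlt => /orP[/eqP->|lti].
  by rewrite vphi'_last // mul0r gtn_eqF // mulr0.
rewrite coord_unitv // eqSS.
by case: (altP (i =P j)) => [->|_] //; rewrite !mulr0.
Qed.

Lemma Y_krylov0 : Y b *m krylov 0 = theta F d (- b) 0 *: krylov 0.
Proof.
apply: coord_eq => i le; rewrite coord_mulY // coordZ coord_col // -(seqY_Yeig _ _ _ c) //;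
  last first.
  by move=> j; apply: vphi_neq0; rewrite eqxx.
by apply: seqY_agree => // k lk; exact: coord_col.
Qed.

Lemma Y_krylov1 : Y b *m krylov 1 =
  theta F d (- b) 1 *: krylov 1 + vphi' F a c d (- b) 1 *: krylov 0.
Proof.
have E : agree F d (coord F d (krylov 1)) (fun i => seqX F a d q i - theta F d a 0 * q i).
  move=> i le; rewrite coordB coordZ coord_mulX // coord_col //; congr (_ - _).
  by apply: seqX_agree le => k lk; exact: coord_col.
apply: coord_eq => i le; rewrite coord_mulY // coordD !coordZ coord_col // E // -seqY_step //;
  last first.
  by move=> j; apply: vphi_neq0; rewrite eqxx.
exact: seqY_agree.
Qed.

(** Induction on consecutive pairs: [Y_krylov0] and [Y_krylov1] start it, and [anticomm2_fix] passes
    from $v_k$, $v_{k+1}$ to $v_{k+2}$. *)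
Lemma D_unitv j : (j <= d)%N -> D *m unitv F d j = 0.
Proof.
suff h k : (k < d)%N -> D *m unitv F d k = 0 /\ D *m unitv F d k.+1 = 0.
  by case: j => [|j] le; [exact: (h 0%N d_gt0).1 | exact: (h j le).2].
elim: k => [|k IH] lt.
  have D0 w : Y b *m (flip *m w) = flip *m (Y (- b) *m w) -> D *m w = 0.
    by move=> h; rewrite /D mulmxBl -!mulmxA h subrr.
  split; apply: D0; rewrite flip_unitv //.
    by rewrite Y_unitv0 -scalemxAr flip_unitv // Y_krylov0.
  by rewrite Y_unitvS // [flip *m (_ + _)]mulmxDr -!scalemxAr !flip_unitv // Y_krylov1.
have [D0 D1] := IH (ltnW lt); split=> //.
have e1 l : (l < d)%N -> unitv F d l.+1 = X *m unitv F d l - th l *: unitv F d l.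
  by move=> ll; rewrite lower_unitv // addrC addKr.
have DX : D *m (X *m unitv F d k) = 0.
  by rewrite lower_unitv ?(ltnW lt) // mulmxDr -scalemxAr D0 D1 scaler0 addr0.
have DXX := anticomm2_fix F a d D _ anticomm2_D D0 DX.
rewrite e1 // {1}(e1 k) ?(ltnW lt) // !mulmxBr -!scalemxAr DXX DX D1 !scaler0 !subr0 //.
Qed.

Lemma Y_flip : Y b *m flip = flip *m Y (- b).
Proof.
apply/eqP; rewrite -subr_eq0; apply/eqP; apply: mx_eq_unitv => j le.
by rewrite mul0mx; exact: D_unitv.
Qed.

(* The entry [(j, j + 1)] of [Y_flip] gives [phi_{j+1} p_{j+1} = phi'_{j+1} p_j] for the diagonal
   [p_j] of [flip]. *)
Lemma flip_diag j : (j <= d)%N -> coord F d (krylov j) j != 0.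
Proof.
elim: j => [|j IH] lt; first by rewrite coord_col // oner_neq0.
have H : Y b *m krylov j.+1 =
    theta F d (- b) j.+1 *: krylov j.+1 + vphi' F a c d (- b) j.+1 *: krylov j.
  rewrite -(flip_unitv j) ?(ltnW lt) // -(flip_unitv j.+1) // mulmxA Y_flip -mulmxA Y_unitvS //.
  by rewrite mulmxDr -!scalemxAr.
have k0 := coord_krylov_lt j.+1 j (ltnW lt) (leqnn _).
suff -> : coord F d (krylov j.+1) j.+1 = (vphi' F a c d b j.+1)^-1 * (vphi' F a c d (- b) j.+1
  * coord F d (krylov j) j).
  by rewrite !mulf_neq0 ?invr_eq0 ?IH ?(ltnW lt) // vphi'E // vphi_neq0 ?eqxx ?orbT.
have ne : vphi' F a c d b j.+1 != 0 by rewrite vphi'E // vphi_neq0 ?eqxx.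
move: (krylov j.+1) H k0 => w /(congr1 (fun w => coord F d w j)) H w0; move: H.
rewrite coord_mulY ?(ltnW lt) // coordD !coordZ /seqY w0 !mulr0 !add0r => <-.
by rewrite mulKf.
Qed.

Lemma flip_unit : flip \in unitmx.
Proof.
rewrite unitmxE det_trig ?unitfE; last first.
  apply/is_trig_mxP => i j lt; rewrite !mxE.
  by have := coord_krylov_lt j i (leq_ord _) lt; rewrite /coord inord_val.
apply/prodf_neq0 => i _; rewrite !mxE.
by have := flip_diag i (leq_ord _); rewrite /coord inord_val.
Qed.

(** [flip] maps the module for $-b$ to the module for $b$, so its inverse is the required [Q]. *)
Lemma flip_module_iso (y : F) : exists Q : 'M[F]_d.+1, [/\ Q \in unitmx, Q *m X = X *m Q,
  Q *m Y b = Y (- b) *m Q & Q *m (X *m Y b + Y b *m X - y%:M) = (X *m Y (- b) + Y (- b) *m X -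
    y%:M) *m Q].
Proof.
have XQ := invmx_intertwine _ _ _ _ _ flip_unit X_flip.
have YQ := invmx_intertwine _ _ _ _ _ flip_unit Y_flip.
exists (invmx flip); rewrite unitmx_inv; split=> //; first exact: flip_unit.
rewrite mulmxBr mulmxBl mulmxDr mulmxDl scalar_mxC; congr (_ + _ - _).
  by rewrite mulmxA XQ -mulmxA YQ mulmxA.
by rewrite mulmxA YQ -mulmxA XQ mulmxA.
Qed.

Lemma split_irreducible (S : 'cV[F]_d.+1 -> Prop) :
  (forall i, (0 < i <= d)%N -> theta F d (- b) i != theta F d (- b) 0) ->
  S 0 -> (forall x u v, S u -> S v -> S (x *: u + v)) ->
  (forall u, S u -> S (X *m u)) -> (forall u, S u -> S (Y b *m u)) ->
  (forall u, S u -> u = 0) \/ (forall u, S u).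
Proof.
move=> th_ne S0 Slin SX SY.
have SD u v : S u -> S v -> S (u + v) by move=> Su Sv; rewrite -[u]scale1r; exact: Slin.
have SZ x u : S u -> S (x *: u) by move=> Su; rewrite -[_ *: _]addr0; exact: Slin.
have SB u v : S u -> S v -> S (u - v) by move=> Su Sv; rewrite addrC -scaleN1r; exact: Slin.
have last_row w : coord F d (Y b *m w) d = theta F d (- b) 0 * coord F d w d.
  rewrite coord_mulY // /seqY vphi'_last // mul0r addr0; congr (_ * _).
  by rewrite /theta -[(-1) ^+ d]signr_odd d_odd; ring.
have full s : S s -> coord F d s d != 0 -> forall u, S u.
  move=> Ss sd.
  (* In the coordinates [invmx flip *m t], $Y_b$ becomes the upper bidiagonal $Y_{-b}$. Applying
     $Y_b-\theta_j(-b)$ for $j=d,\dots,1$ clears them from the last one down to index 1, while the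
     last coordinate of [t] is only multiplied by nonzero factors $\theta_0(-b)-\theta_j(-b)$. *)
  have [t [St td tz]] : exists t, [/\ S t, coord F d t d != 0 &
       forall i, (0 < i <= d)%N -> coord F d (invmx flip *m t) i = 0].
    suff : forall k, (k <= d)%N -> exists t, [/\ S t, coord F d t d != 0 &
       forall i, (d - k < i <= d)%N -> coord F d (invmx flip *m t) i = 0].
      by move=> /(_ d (leqnn d)); rewrite subnn.
    elim=> [|k IH] le.
      by exists s; split=> // i /andP[]; rewrite subn0 ltnNge => /negPf->.
    have [t [St td tz]] := IH (ltnW le).
    set j := (d - k)%N; have j_d : (0 < j <= d)%N by rewrite /j subn_gt0 le leq_subr.
    exists (Y b *m t - theta F d (- b) j *: t); split.
    - by apply: SB; [exact: SY | exact: SZ].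
    - by rewrite coordB coordZ last_row -mulrBl mulf_neq0 // subr_eq0 eq_sym th_ne.
    move=> i /andP[lo hi].
    have -> : invmx flip *m (Y b *m t - theta F d (- b) j *: t) =
       Y (- b) *m (invmx flip *m t) - theta F d (- b) j *: (invmx flip *m t).
      rewrite mulmxBr -scalemxAr; congr (_ - _).
      by rewrite !mulmxA (invmx_intertwine _ _ _ _ _ flip_unit Y_flip).
    have ji : (j <= i)%N by rewrite /j; move: lo le; clear; lia.
    rewrite coordB coordZ coord_mulY // /seqY.
    have -> : vphi' F a c d (- b) i.+1 * coord F d (invmx flip *m t) i.+1 = 0.
      move: hi; rewrite leq_eqVlt => /orP[/eqP->|hi]; first by rewrite vphi'_last // mul0r.
      by rewrite tz ?mulr0 // ltnS ji.
    move: ji; rewrite addr0 leq_eqVlt => /orP[/eqP->|ji]; first by rewrite subrr.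
    by rewrite tz ?ji // !mulr0 subr0.
  have tE : t = coord F d (invmx flip *m t) 0 *: krylov 0.
    rewrite -[LHS](mulKVmx flip_unit) -flip_unitv // scalemxAr; congr (_ *m _).
    apply: coord_eq => -[|i] le; rewrite coordZ coord_unitv //= ?mulr1 // mulr0 tz //.
  have q0 : S (krylov 0).
    rewrite -[krylov 0](scalerK (_ : coord F d (invmx flip *m t) 0 != 0)).
      by apply: SZ; rewrite -tE.
    by apply: contraNneq td => z; rewrite tE z scale0r coord0.
  (* Cyclicity of $q$ under $X$: the Krylov vectors are the columns of the invertible [flip]. *)
  have qS j : S (krylov j) by elim: j => //= j IH; apply: SB; [exact: SX | exact: SZ].
  move=> u; rewrite -[u](mulKVmx flip_unit); set v := invmx _ *m u.
  have -> : flip *m v = \sum_(j < d.+1) v j 0 *: krylov j.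
    apply/colP => i; rewrite mxE summxE; apply: eq_bigr => j _.
    by rewrite !mxE mulrC.
  by apply: (big_ind S) => // j _; exact: SZ.
have [[s [Ss sd]]|none] := boolp.pselect (exists s, S s /\ coord F d s d != 0).
  by right; exact: full Ss sd.
left=> u Su; apply: coord_eq => i le; rewrite coord0.
have {none} vd w : S w -> coord F d w d = 0.
  by move=> Sw; apply/eqP/negP => /negP wd; apply: none; exists w.
(* If the last coordinate vanishes on all of [S], stability under $X$ carries this to the preceding
   coordinate, and so on down to index 0. *)
have : forall k, (k <= d)%N -> forall w, S w -> coord F d w (d - k) = 0.
  elim=> [|k IH] lk w Sw; first by rewrite subn0 vd.
  have := IH (ltnW lk) _ (SX _ Sw); rewrite coord_lower ?leq_subr // (IH (ltnW lk)) // mulr0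
    add0r.
  by have -> : (d - k)%N = (d - k.+1).+1 by rewrite subnSK.
by move=> /(_ (d - i)%N (leq_subr _ _) u Su); rewrite subKn.
Qed.

End Flip.

(** * The module of monogenic spinors *)

Section MonogenicModule.
Variables (F : fieldType) (im k1 k2 k3 : F) (n : nat).
Hypothesis im2 : im * im = -1.
Hypothesis two_neq0 : 2%:R != 0 :> F.
Hypothesis n_odd : odd n.
Hypothesis k1_reg : forall j, (0 < j <= n)%N -> dint F k1 j != 0.
Hypothesis k3_reg : forall j, (0 < j <= n)%N -> dint F k3 j != 0.

Local Notation h := (n.+1%:R / 2%:R : F).
Local Notation pa := (k2 + k3 + h).
Local Notation pb := (- k1 - k3 - h).
Local Notation pc := (k1 + k2 + h).
Local Notation X := (lower_bidiag F n (theta F n pa)).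
Local Notation Y := (upper_bidiag F n (theta F n pb) (vphi F pa pc n pb)).
Local Notation Z := (X *m Y + Y *m X - (pc ^+ 2 - pa ^+ 2 - pb ^+ 2 + n.+1%:R ^+ 2 / 4%:R)%:M).

Let four_neq0 : 4%:R != 0 :> F := four_neq0 F two_neq0.

Lemma theta_pa i : theta F n pa i = th F k2 k3 i.
Proof. by rewrite /theta /th /sgn -addn1 natrD; field. Qed.

Lemma theta_pb i : theta F n pb i = thetaY F k1 k3 n i.
Proof. by rewrite /theta /thetaY /sgn -addn1 natrD; field. Qed.

(** For odd $i$ this is $c^2-e^2=(c+e)(c-e)$ with $c+e=i+2k_2$ and $c-e=n+1-i+2k_1$; for even $i$
    both sides are $i(n+1-i)$. *)
Lemma phiY_vphi' i : (i <= n.+1)%N -> phiY F k1 k2 n i = vphi' F pa pc n pb i.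
Proof.
move=> le; rewrite /phiY /vphi' /dint natrB //.
have -> : sgn F (n.+1 - i) = sgn F i.
  by rewrite /sgn -signr_odd oddB //= n_odd addFb signr_odd.
by rewrite /sgn -signr_odd -addn1 natrD; case: (odd i) => /=; field; rewrite ?two_neq0 ?four_neq0.
Qed.

Lemma phiY_vphi i : (0 < i <= n)%N -> phiY F k1 k2 n i = vphi F pa pc n pb i.
Proof. by move=> /[dup] ? /andP[_ le]; rewrite phiY_vphi' ?vphi'E // ltnW. Qed.

Lemma coord_X w : agree F n (coord F n (X *m w)) (biX_seq F k2 k3 (coord F n w)).
Proof. by move=> i le; rewrite coord_mulX // /seqX theta_pa. Qed.

Lemma coord_Y w : agree F n (coord F n (Y *m w)) (biY_seq F k1 k2 k3 n (coord F n w)).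
Proof. by move=> i le; rewrite coord_mulY // /seqY /biY_seq theta_pb phiY_vphi'. Qed.

Lemma coord_Z w : agree F n (coord F n (Z *m w)) (biZ_seq F k1 k2 n (coord F n w)).
Proof.
move=> i le; rewrite mulmxBl mulmxDl mul_scalar_mx -!mulmxA coordB coordD coordZ.
rewrite (biZ_seqE _ _ _ k3) // coord_X // coord_Y //; congr (_ + _ - _).
  case: i le => [|i] le; rewrite /biX_seq /mulvar ?coord_Y //; exact: ltnW.
rewrite /biY_seq; move: le; rewrite leq_eqVlt => /orP[/eqP->|lt]; last by rewrite !coord_X //
  ltnW.
by rewrite phiY_last !mul0r coord_X.
Qed.

Lemma ck_coef_neq0 s i : (i <= n)%N -> ck_coef F im k1 n s i != 0.
Proof.
have im_neq0 : im != 0 by apply: contra_eq_neq im2 => ->; rewrite mul0r eq_sym oppr_eq0 oner_eq0.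
elim: i => [|i IH] lt /=; first exact: oner_neq0.
by rewrite !mulf_neq0 ?IH ?signr_eq0 ?k1_reg ?(ltnW lt) // subn_gt0 lt leq_subr.
Qed.

Local Notation vec2 := ('cV[F]_n.+1 * 'cV[F]_n.+1)%type.

Definition component (w : vec2) (s : bool) : nat -> F := coord F n (if s then w.2 else w.1).

(** The isomorphism on arrays: each copy of $W$ prescribes one spinor component at $x_3=0$, and the
    pair is then extended. *)
Definition arr (w : vec2) : array F :=
  ck_array F im k1 k2 k3 n (fun s i => ck_coef F im k1 n s i * component w s i).

Lemma arr_monogenic w : monogenic F im k1 k2 k3 n (arr w).
Proof. exact: monogenic_ck. Qed.

Lemma arr_restricts w s : restricts F im k1 n (arr w) s (component w s).
Proof. by move=> i le; rewrite /arr /ck_array addn0 subnK // eqxx. Qed.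

(** Reduces the intertwining identities below to their restrictions at $x_3=0$. *)
Lemma arr_unique f w : monogenic F im k1 k2 k3 n f ->
  (forall s, restricts F im k1 n f s (component w s)) ->
  forall s a b c, f s a b c = arr w s a b c.
Proof.
move=> mf fw; apply: (monogenic_uniq _ _ _ _ _ _ _ _ _ _ mf (arr_monogenic w)) => // s a b.
case: (altP (a + b =P n)%N) => [E|ne]; last first.
  by have [hf _] := mf; have [hg _] := arr_monogenic w; rewrite hf ?hg ?addn0.
have le : (b <= n)%N by lia.
have -> : a = (n - b)%N by lia.
by rewrite fw // arr_restricts.
Qed.

Lemma restricts_agree f s w w' : agree F n w w' ->
  restricts F im k1 n f s w -> restricts F im k1 n f s w'.
Proof. by move=> ww fw i le; rewrite fw // ww. Qed.

Lemma arr_X w s a b c : biX_arr F im k2 k3 (arr w) s a b c = arr (X *m w.1, X *m w.2) s a b c.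
Proof.
move: s a b c; apply: arr_unique => [|s].
  by apply: monogenic_biX => //; exact: arr_monogenic.
have := restricts_biX F im im2 k1 k2 k3 two_neq0 n n_odd (arr w) s _ (arr_monogenic w)
  (arr_restricts w s).
by apply: restricts_agree => i le; rewrite /component; case: s => /=; rewrite coord_X.
Qed.

Lemma arr_Y w s a b c : biY_arr F im k1 k3 (arr w) s a b c = arr (Y *m w.1, Y *m w.2) s a b c.
Proof.
move: s a b c; apply: arr_unique => [|s].
  by apply: monogenic_biY => //; exact: arr_monogenic.
have := restricts_biY F im im2 k1 k2 k3 two_neq0 n n_odd (arr w) s _ (arr_monogenic w)
  (arr_restricts w s).
by apply: restricts_agree => i le; rewrite /component; case: s => /=; rewrite coord_Y.
Qed.

Lemma arr_Z w s a b c : biZ_arr F im k1 k2 (arr w) s a b c = arr (Z *m w.1, Z *m w.2) s a b c.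
Proof.
move: s a b c; apply: arr_unique => [|s].
  by apply: monogenic_biZ => //; exact: arr_monogenic.
have := restricts_biZ F im im2 k1 k2 k3 two_neq0 n n_odd (arr w) s _ (arr_monogenic w)
  (arr_restricts w s).
by apply: restricts_agree => i le; rewrite /component; case: s => /=; rewrite coord_Z.
Qed.

Lemma arr_linear x w w' s a b c :
  arr (x *: w + w') s a b c = x * arr w s a b c + arr w' s a b c.
Proof.
symmetry; move: s a b c.
have [h1 d1] := arr_monogenic w; have [h2 d2] := arr_monogenic w'.
apply: arr_unique => [|s i le].
  split=> [s a b c ne|s a b c]; first by rewrite h1 // h2 // mulr0 addr0.
  transitivity (x * dirac_arr F im k1 k2 k3 (arr w) s a b c + dirac_arr F im k1 k2 k3 (arr w')
    s a b c).
    by rewrite /dirac_arr; ring.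
  by rewrite d1 d2 mulr0 addr0.
rewrite !arr_restricts //.
have -> : component (x *: w + w') s i = x * component w s i + component w' s i by case: s;
  rewrite /component /= coordD coordZ.
by ring.
Qed.

Lemma arr_inj w w' : (forall s a b c, arr w s a b c = arr w' s a b c) -> w = w'.
Proof.
move=> e.
have E s i : (i <= n)%N -> component w s i = component w' s i.
  by move=> le; apply: (mulfI (ck_coef_neq0 s i le)); rewrite -!arr_restricts.
case: w w' {e} E => [u v] [u' v'] E; congr (_, _); apply: coord_eq.
  exact: (E false).
exact: (E true).
Qed.

Lemma arr_surj f : monogenic F im k1 k2 k3 n f ->
  exists w, forall s a b c, f s a b c = arr w s a b c.
Proof.
move=> mf; pose g s i := f s (n - i)%N i 0%N / ck_coef F im k1 n s i.
exists (\col_i g false i, \col_i g true i); apply: arr_unique => // s i le.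
have -> : component (\col_i g false i, \col_i g true i) s i = g s i.
  by rewrite /component; case: s; rewrite coord_col.
by rewrite /g mulrC divfK // ck_coef_neq0.
Qed.

End MonogenicModule.

(** * Nonvanishing for nonnegative $k_1,k_2,k_3$ *)

Section Positivity.
Variables (F : numFieldType) (k1 k2 k3 : F) (n : nat).
Hypothesis n_odd : odd n.
Hypotheses (k1_ge0 : 0 <= k1) (k2_ge0 : 0 <= k2) (k3_ge0 : 0 <= k3).

Local Notation h := (n.+1%:R / 2%:R : F).
Local Notation pa := (k2 + k3 + h).
Local Notation pb := (- k1 - k3 - h).
Local Notation pc := (k1 + k2 + h).

(** $\theta_j(-b)=(-1)^j(k_1+k_3+\tfrac12+j)$ is negative for odd $j$, positive at $j=0$, and
    exceeds the latter value by $j$ for even $j$. *)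
Lemma theta_flip_neq i : (0 < i)%N -> theta F n (- pb) i != theta F n (- pb) 0.
Proof.
move=> i_gt0.
have E j : theta F n (- pb) j = (-1) ^+ j * (k1 + k3 + 2%:R^-1 + j%:R).
  by rewrite /theta -addn1 natrD; field; rewrite ?pnatr_eq0.
have s_gt0 : 0 < k1 + k3 + 2%:R^-1 by rewrite ltr_wpDl ?addr_ge0 // invr_gt0 ltr0n.
rewrite !E expr0 mul1r addr0 -signr_odd -subr_eq0; case: odd; rewrite /= ?expr1 ?mulN1r ?mul1r.
  by rewrite -opprD oppr_eq0 gt_eqF // addr_gt0 // ltr_wpDr ?ler0n.
by rewrite addrAC subrr add0r pnatr_eq0 -lt0n.
Qed.

Lemma dint_gt0 (k : F) j : 0 <= k -> (0 < j)%N -> 0 < dint F k j.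
Proof.
move=> k_ge0 j_gt0; rewrite ltr_pwDl ?ltr0n // mulr_ge0 //.
by rewrite /sgn -signr_odd; case: odd; rewrite /= ?expr1 ?opprK ?subrr ?addr_ge0 ?ler01.
Qed.

(** At [pb] the entry is the product [phiY] of positive factors; at [- pb] and odd $i$, the
    difference of squares is minus a product of two positive factors. *)
Lemma vphi_flip_neq0 y i : (y == pb) || (y == - pb) -> (0 < i <= n)%N ->
  vphi F pa pc n y i != 0.
Proof.
have two : 2%:R != 0 :> F by rewrite pnatr_eq0.
move=> yb lei; have /andP[i_gt0 i_le] := lei.
case/orP: yb => /eqP->.
  by rewrite -(phiY_vphi F k1 k2 k3 n two n_odd i lei) mulf_neq0 // gt_eqF // dint_gt0 //
    subn_gt0.
rewrite /vphi; case: (boolP (odd i)) => _ /=; last by rewrite pnatr_eq0 -lt0n muln_gt0 i_gt0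
  addn1.
have -> : pc ^+ 2 - (2%:R * pa + 2%:R * - pb - n%:R + 2%:R * i%:R - 1) ^+ 2 / 4%:R =
   - ((k3 *+ 2 + i%:R) * ((k1 + k2 + k3) *+ 2 + (n + 1 + i)%N%:R)).
  by rewrite !natrD -addn1 natrD; field; rewrite ?pnatr_eq0.
rewrite oppr_eq0 mulf_neq0 // gt_eqF // ltr_wpDl ?mulrn_wge0 ?addr_ge0 ?ltr0n //.
by rewrite addn_gt0 i_gt0 orbT.
Qed.

End Positivity.

(** * Passage between polynomial spinors and arrays *)

Section Transport.
Variable R : realType.
Local Notation C := (complex R).

Lemma two_neq0C : 2%:R != 0 :> C. Proof. by rewrite pnatr_eq0. Qed.

Lemma mulii : 'i * 'i = -1 :> C. Proof. by rewrite -expr2 sqrCi. Qed.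

Lemma rC_dint (k : R) j : dint C (rC k) j = rC (dint R k j).
Proof.
change (dint C (real_complex R k) j = real_complex R (dint R k j)).
by rewrite /dint /sgn rmorphD rmorphM rmorphB rmorphXn rmorphN rmorph1 rmorph_nat.
Qed.

(** [dint k j] is $j$ for even $j$ and $j+2k$ for odd $j$; the latter vanishes only if $2k=-j$, and
    then [below_t] forces $n<j$. *)
Lemma below_t_dint (k : R) n j : below_t k n -> (0 < j <= n)%N -> dint C (rC k) j != 0.
Proof.
move=> kn /andP[j0 jn]; rewrite rC_dint.
suff: dint R k j != 0 by apply: contraNN => /eqP[->].
rewrite /dint /sgn -signr_odd; case: (boolP (odd j)) => oj; last first.
  by rewrite subrr mulr0 addr0 pnatr_eq0 -lt0n.
rewrite /= expr1; apply/eqP => e.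
have E : 2%:R * k = - j%:R by rewrite -[RHS]add0r -e; ring.
have jE : (2 * j./2 + 1)%N = j by rewrite mul2n addnC -[RHS]odd_double_half oj.
have := kn j./2; rewrite jE.
by move=> /(_ E); rewrite E opprK ltr_nat ltnNge jn.
Qed.

Definition pair_of_array n (f : array C) : Pair R :=
  (\sum_(m : 'X_{1..3 < n.+1}) f false (m i1) (m i2) (m i3) *: 'X_[m],
   \sum_(m : 'X_{1..3 < n.+1}) f true (m i1) (m i2) (m i3) *: 'X_[m]).

Lemma pair_of_arrayE n f : homog_array C n f -> represents R (pair_of_array n f) f.
Proof.
move=> hf s a b c; rewrite /coef.
have H g : (forall a b c, (a + b + c)%N != n -> g a b c = 0) ->
   (\sum_(m : 'X_{1..3 < n.+1}) g (m i1) (m i2) (m i3) *: 'X_[m] : Pol R)@_(mnm3 a b c) = g a b c.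
  move=> hg; case: (leqP (a + b + c) n) => le.
    by rewrite (mcoeff_mpoly (fun m : 'X_{1..3} => g (m i1) (m i2) (m i3))) ?mdeg_mnm3 // !mnm3K.
  rewrite hg ?gtn_eqF // raddf_sum /= big1 // => m _; rewrite mcoeffZ mcoeffX.
  case: eqP => [E|]; last by rewrite mulr0.
  by have := bmdeg m; rewrite E mdeg_mnm3 ltnS leqNgt le.
by case: s; apply: H => a' b' c' ne; apply: hf.
Qed.

Lemma homog_mcoeff n (p : Pol R) :
  p \is n.-homog <-> forall a b c, (a + b + c)%N != n -> p@_(mnm3 a b c) = 0.
Proof.
split=> [hp a b c ne|hp].
  by move: ne; rewrite -mdeg_mnm3 => ne; exact: (dhomog_nemf_coeff hp ne).
apply/dhomogP => m; rewrite mcoeff_msupp => nz.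
apply/eqP; apply: contraNT nz => ne; rewrite [m]mnm3E hp //.
by rewrite -mdeg_mnm3 -mnm3E.
Qed.

Lemma inMn_monogenic k1 k2 k3 n (u : Pair R) :
  inMn k1 k2 k3 n u <-> monogenic C 'i (rC k1) (rC k2) (rC k3) n (coef R u).
Proof.
have rD := rep_Dirac R k1 k2 k3 u (coef R u) (fun _ _ _ _ => erefl).
split=> [[h1 [h2 D0]]|[hf df]].
  split=> s a b c; last by rewrite -rD D0; case: s; exact: mcoeff0.
  by case: s => ne; [apply: (proj1 (homog_mcoeff n u.2) h2)|apply: (proj1 (homog_mcoeff n u.1)
    h1)].
split; last split.
- by apply/homog_mcoeff => a b c; exact: (hf false).
- by apply/homog_mcoeff => a b c; exact: (hf true).
by apply: coef_inj => s a b c; rewrite rD df; case: s; symmetry; exact: mcoeff0.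
Qed.

End Transport.

(** * The decomposition of $\mathscr M_n$ and the two forms of $W$ *)

Theorem theorem6p3 (R : realType) (k1 k2 k3 : R) (n : nat) :
  odd n -> (1 <= n)%N ->
  below_t k1 n -> below_t k2 n -> below_t k3 n ->
  let h : complex R := (n.+1)%:R / 2%:R in
  let a := rC k2 + rC k3 + h in
  let b := - rC k1 - rC k3 - h in
  let c := rC k1 + rC k2 + h in
  (* M_n is isomorphic to W (+) W, W = E_n(a, b, c) *)
  (exists psi : 'cV[complex R]_(n.+1) * 'cV[complex R]_(n.+1) -> Pair R,
      (forall (s : complex R) w1 w2,
          psi (s *: w1 + w2) = addP (scaleP s (psi w1)) (psi w2)) /\
      injective psi /\
      (forall u, inMn k1 k2 k3 n u <-> exists w, u = psi w) /\
      (forall w, BIX k1 k2 k3 (psi w)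
                 = psi (EX a n *m w.1, EX a n *m w.2)) /\
      (forall w, BIY k1 k2 k3 (psi w)
                 = psi (EY a b c n *m w.1, EY a b c n *m w.2)) /\
      (forall w, BIZ k1 k2 k3 (psi w)
                 = psi (EZ a b c n *m w.1, EZ a b c n *m w.2)))
  /\
  (0 <= k1 -> 0 <= k2 -> 0 <= k3 ->
     irreducible3 (EX a n) (EY a b c n) (EZ a b c n) /\
     exists Q : 'M[complex R]_(n.+1), Q \in unitmx /\
       Q *m EX a n = EX a n *m Q /\
       Q *m EY a b c n = EY a (- b) c n *m Q /\
       Q *m EZ a b c n = EZ a (- b) c n *m Q).
Proof.
move=> n_odd n_gt0 k1n k2n k3n h a b c.
have k1r j := below_t_dint R k1 n j k1n.
have k3r j := below_t_dint R k3 n j k3n.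
have two := two_neq0C R.
have ii := mulii R.
split.
  pose A := arr (complex R) 'i (rC k1) (rC k2) (rC k3) n.
  exists (fun w => pair_of_array R n (A w)).
  have mono w : monogenic (complex R) 'i (rC k1) (rC k2) (rC k3) n (A w).
    exact: arr_monogenic.
  have rep w : represents R (pair_of_array R n (A w)) (A w).
    by apply: pair_of_arrayE; case: (mono w).
  (* Spinors are determined by their coefficients, so claims about [psi] become claims about
     [arr]. *)
  have ext u w : represents R u (A w) -> u = pair_of_array R n (A w).
    by move=> uw; apply: coef_inj => s x y z; rewrite uw rep.
  split=> [s w1 w2|].
    symmetry; apply: ext => e x y z.
    rewrite (rep_add _ _ _ _ _ (rep_scale _ s _ _ (rep w1)) (rep w2)).
    by rewrite /A arr_linear.
  split=> [w w' E|].
    apply: (arr_inj _ 'i (rC k1) (rC k2) (rC k3) _ ii k1r) => s x y z.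
    exact: (etrans (esym (rep w s x y z)) (etrans (congr1 (fun u => coef R u s x y z) E) (rep
      w' s x y z))).
  split=> [u|].
    rewrite inMn_monogenic; split=> [mu|[w ->]]; last first.
      have [hA dA] := mono w; split=> s x y z; first by move=> ne; rewrite rep hA.
      transitivity (dirac_arr (complex R) 'i (rC k1) (rC k2) (rC k3) (A w) s x y z) => //.
      by rewrite /dirac_arr !rep.
    have [w hw] := arr_surj (complex R) 'i (rC k1) (rC k2) (rC k3) n ii two n_odd k1r k3r _ mu.
    by exists w; apply: ext => s x y z; rewrite hw.
  split=> [w|]; last split=> w.
  - by apply: ext => s x y z; rewrite (rep_BIX _ _ _ _ _ _ (rep w)) arr_X.
  - by apply: ext => s x y z; rewrite (rep_BIY _ _ _ _ _ _ (rep w)) arr_Y.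
  - by apply: ext => s x y z; rewrite (rep_BIZ _ _ _ _ _ _ (rep w)) arr_Z.
move=> k1_ge0 k2_ge0 k3_ge0.
have rC_ge0 (k : R) : 0 <= k -> 0 <= rC k by move=> k_ge0; rewrite lecE /= eqxx.
have [K1 K2 K3] : [/\ 0 <= rC k1, 0 <= rC k2 & 0 <= rC k3] by split; exact: rC_ge0.
have hphi := vphi_flip_neq0 (complex R) _ _ _ n n_odd K1 K2 K3.
have hth i : (0 < i <= n)%N -> theta (complex R) n (- b) i != theta (complex R) n (- b) 0.
  by case/andP=> i0 _; exact: (theta_flip_neq (complex R) _ (rC k3) n K1 K3 i i0).
split.
  move=> S S0 Slin SX SY _.
  exact: (split_irreducible (complex R) a b c n n_odd two hphi S hth S0 Slin SX SY).
have [Q [U QX QY QZ]] := flip_module_iso (complex R) a b c n n_odd two hphi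
  (c ^+ 2 - a ^+ 2 - b ^+ 2 + n.+1%:R ^+ 2 / 4%:R).
exists Q; split; first exact: U.
split; first exact: QX.
split; first exact: QY.
(* The scalar in $Z$ depends on $b^2$ only, so it is the same for $b$ and $-b$. *)
by rewrite /EZ sqrrN; exact: QZ.
Qed.
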